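(* Let $\mathcal{M}$ be a compact connected smooth Riemannian manifold without boundary, let $\Psi$ be the Laplace exponent of a driftless subordinator with Lévy measure $\nu$, and let $T(m)$, $m\in\mathcal{M}$, be a Gaussian random field satisfying (A.1)-(A.4) of the context, with expansion $T(m)=\sum_{j\in\mathbb{N}}\phi_j(m)c_j$, $c_j=\int_{\mathcal{M}}T(m)\phi_j(m)\,\mu(dm)$. The solution to $$\left(\partial_t-\mathbb{D}^\Psi_{\mathcal{M}}\right)u(m,t)=0$$ subject to the random initial condition $$u(m,0)=T_0(m)=T(m)\in L^2(\mathcal{M})$$ is the time-dependent random field on $\mathcal{M}$ $$u(m,t)=T^\Psi_t(m)=\sum_{j\in\mathbb{N}}e^{-t\Psi(\lambda_j)}\phi_j(m)\,c_j.$$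
   Context: $\mu$ is the Riemannian measure, $\triangle$ the Laplace-Beltrami operator, $\{\phi_j\}_{j\in\mathbb{N}}$ a complete orthonormal basis of $L^2(\mathcal{M})=L^2(\mathcal{M},\mu)$ of real eigenfunctions with $\triangle\phi_j=-\lambda_j\phi_j$, $0=\lambda_1<\lambda_2\le\cdots\uparrow\infty$ (with multiplicity). Conditions on $T$: (A.1) almost surely continuous sample paths; (A.2) $\mathbb{E}T(m)=0$; (A.3) $\mathbb{E}[\int_{\mathcal{M}}T^2(m)\mu(dm)]<\infty$; (A.4) continuous covariance function $\mathscr{K}(m_1,m_2)=\mathbb{E}[T(m_1)T(m_2)]$. The expansion of $T$ in the $\phi_j$ holds in $L^2(dP\otimes d\mu)$; expansions of random fields in the $\phi_j$ are understood in this sense. $\Psi(\xi)=\int_0^\infty(1-e^{-s\xi})\,\nu(ds)$, where $\nu$ is a measure on $(0,\infty)$ with $\int_0^\infty(s\wedge1)\,\nu(ds)<\infty$. With $P_s=e^{s\triangle}$ the heat semigroup ($P_s\phi_j=e^{-s\lambda_j}\phi_j$), the operator $\mathbb{D}^\Psi_{\mathcal{M}}$ is $$\mathbb{D}^\Psi_{\mathcal{M}}f(x)=\int_0^\infty\left(P_sf(x)-f(x)\right)\nu(ds)=-\sum_{j\in\mathbb{N}}f_j\,\Psi(\lambda_j)\,\phi_j(x),\qquad f_j=\int_{\mathcal{M}}f\phi_j\,d\mu.$$ *)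

(* Defs.v *)
From HB Require Import structures.
From mathcomp Require Import all_boot all_order all_algebra.
From mathcomp Require Import all_classical all_reals all_analysis.

Set Implicit Arguments.
Unset Strict Implicit.
Unset Printing Implicit Defensive.

Import Order.TTheory GRing.Theory Num.Theory.
Import numFieldNormedType.Exports.

Local Open Scope classical_set_scope.
Local Open Scope ring_scope.

Section euclidean.
Context {R : realType}.

Definition partial n (k : 'I_n) (f : 'rV[R]_n -> R) : 'rV[R]_n -> R :=
  'D_(delta_mx 0 k) f.

(* C^oo on U, for U open: all iterated partial derivatives exist and are
   continuous at every point of U. *)
Definition smooth_on n (U : set 'rV[R]_n) (f : 'rV[R]_n -> R) : Prop :=
  forall (s : seq 'I_n) (x : 'rV[R]_n), U x ->
    {for x, continuous (foldr (@partial n) f s)} /\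
    (forall k, derivable (foldr (@partial n) f s) x (delta_mx 0 k)).

(* Lebesgue integral on R^n of a nonnegative Borel function, as an iterated
   integral (Tonelli). *)
Fixpoint lebesgue_int n : ('rV[R]_n -> \bar R) -> \bar R :=
  match n with
  | 0 => fun f => f 0
  | n'.+1 => fun f => (\int[@lebesgue_measure R]_x
      lebesgue_int (fun v : 'rV_n' => f (row_mx (x%:M : 'rV_1) v)))%E
  end.

(* (det G)^(-1/2) d_k ((det G)^(1/2) G^{kl} d_l f), summed over k and l. *)
Definition laplace_coord n (G : 'rV[R]_n -> 'M[R]_n) (f : 'rV[R]_n -> R)
    (x : 'rV[R]_n) : R :=
  (Num.sqrt (\det (G x)))^-1 *
  \sum_(k < n) partial k (fun y => Num.sqrt (\det (G y)) *
    \sum_(l < n) invmx (G y) k l * partial l f y) x.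

End euclidean.

(* A smooth atlas on M together with a smooth Riemannian metric, given by its
   matrix (met i x)_{kl} = g(d_k, d_l) in each chart. Outside [chart_dom i],
   resp. outside its image, [chart i], resp. [chart_inv i] and [met i], are
   junk. *)
Record riemannian_structure (R : realType) (n : nat) (M : topologicalType) :=
  RiemannianStructure {
  chart_index : Type;
  chart_dom : chart_index -> set M;
  chart : chart_index -> M -> 'rV[R]_n;
  chart_inv : chart_index -> 'rV[R]_n -> M;
  met : chart_index -> 'rV[R]_n -> 'M[R]_n;
  chart_im := fun i => chart i @` chart_dom i;
  transition := fun i j => chart j \o chart_inv i;
  overlap := fun i j => chart i @` (chart_dom i `&` chart_dom j);
  chart_cover : forall m, exists i, chart_dom i m;
  chart_dom_open : forall i, open (chart_dom i);
  chart_im_open : forall i, open (chart_im i);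
  chartK : forall i m, chart_dom i m -> chart_inv i (chart i m) = m;
  chart_continuous : forall i m, chart_dom i m ->
    {for m, continuous (chart i)};
  chart_inv_continuous : forall i x, chart_im i x ->
    {for x, continuous (chart_inv i)};
  transition_smooth : forall i j k,
    smooth_on (overlap i j) (fun x => transition i j x 0 k);
  met_smooth : forall i k l, smooth_on (chart_im i) (fun x => met i x k l);
  met_sym : forall i x, chart_im i x -> (met i x)^T = met i x;
  met_posdef : forall i x, chart_im i x ->
    forall v : 'rV[R]_n, v != 0 -> 0 < (v *m met i x *m v^T) 0 0;
  (* (jacobian f x) k l = d_k f_l: vectors are rows *)
  met_transition : forall i j x, overlap i j x ->
    met i x = jacobian (transition i j) x *m met j (transition i j x)
              *m (jacobian (transition i j) x)^T
}.

Notation borel M := (g_sigma_algebraType (@open M)).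

Section manifold.
Context {R : realType} {n : nat} {M : ptopologicalType}.
Variable g : riemannian_structure R n M.

Definition smooth_fun (f : M -> R) : Prop :=
  forall i : chart_index g, smooth_on (chart_im i) (f \o chart_inv i).

(* The Laplace-Beltrami operator, computed at m in the chart i around m (the
   value does not depend on the chart when f is smooth). *)
Definition laplace_beltrami (i : chart_index g) (f : M -> R) (m : M) : R :=
  laplace_coord (met i) (f \o chart_inv i) (chart i m).

Definition is_riemannian_measure (mu : set (borel M) -> \bar R) : Prop :=
  forall (i : chart_index g) (A : set (borel M)), measurable A ->
    A `<=` chart_dom i ->
    mu A = lebesgue_int (fun x =>
      (\1_(chart i @` A) x * Num.sqrt (\det (met i x)))%:E).

End manifold.

Section L2.
Context {d : measure_display} {X : measurableType d} {R : realType}.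
Variable mu : {measure set X -> \bar R}.

Definition L2 (f : X -> R) : Prop := f \in Lfun mu 2%:E.

Definition L2dist (f h : X -> R) : \bar R :=
  'N[mu]_2%:E[(fun x => (f x - h x)%:E)]%E.

Definition L2_sum (a : nat -> X -> R) (f : X -> R) : Prop :=
  L2 f /\ L2dist (fun x => \sum_(j < N) a j x) f @[N --> \oo] --> 0%E.

Definition L2_inner (f h : X -> R) : R := \int[mu]_x (f x * h x).

End L2.

Section spectral.
Context {R : realType} {n : nat} {M : ptopologicalType}.
Variable g : riemannian_structure R n M.
Variable mu : {measure set (borel M) -> \bar R}.

(* Eigenvalues are indexed from 0. *)
Record is_eigenbasis (lambda : nat -> R) (phi : nat -> M -> R) : Prop := {
  eigen_smooth : forall j, smooth_fun g (phi j);
  eigen_eq : forall j (i : chart_index g) m, chart_dom i m ->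
    laplace_beltrami i (phi j) m = - lambda j * phi j m;
  eigen_orthonormal : forall j k, L2_inner mu (phi j) (phi k) = (j == k)%:R;
  eigen_complete : forall f, L2 mu f ->
    L2_sum mu (fun j m => L2_inner mu f (phi j) * phi j m) f;
  eigen_val0 : lambda 0%N = 0;
  eigen_val1 : 0 < lambda 1%N;
  eigen_val_mono : forall j k, (j <= k)%N -> lambda j <= lambda k;
  eigen_val_cvg : lambda j @[j --> \oo] --> +oo
}.

Variables (lambda : nat -> R) (phi : nat -> M -> R).

(* P_s f = e^{s Delta} f, an L^2 class, of which a representative is chosen. *)
Definition heat (s : R) (f : M -> R) : M -> R :=
  xget (fun=> 0) [set h | L2_sum mu
    (fun j m => expR (- s * lambda j) * L2_inner mu f (phi j) * phi j m) h].

Variable nu : {measure set (measurableTypeR R) -> \bar R}.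

(* Only the restriction of nu to ]0, +oo[ matters. *)
Definition is_levy_measure : Prop :=
  (\int[nu]_(s in `]0%R, +oo[) (Num.min s 1)%:E < +oo)%E.

Definition laplace_exponent (xi : R) : R :=
  \int[nu]_(s in `]0, +oo[) (1 - expR (- s * xi)).

(* D f = h, with D f = \int_0^oo (P_s f - f) nu(ds) as a weak (Pettis) integral
   with values in L^2(M). The f for which it exists are those with
   \sum_j (Psi(lambda_j) f_j)^2 < oo, i.e. those for which the series
   - \sum_j f_j Psi(lambda_j) phi_j converges in L^2(M). *)
Definition subordinate_gen (f h : M -> R) : Prop :=
  [/\ L2 mu f, L2 mu h &
   forall q : M -> R, L2 mu q ->
     nu.-integrable `]0, +oo[
       (fun s => (L2_inner mu (fun m => heat s f m - f m) q)%:E) /\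
     L2_inner mu h q =
       \int[nu]_(s in `]0, +oo[) L2_inner mu (fun m => heat s f m - f m) q].

End spectral.

Section random_field.
Context {d : measure_display} {Omega : measurableType d} {R : realType}.
Variable P : probability Omega R.

(* Degenerate (constant) laws included. *)
Definition gaussian (X : Omega -> R) : Prop :=
  exists (a s : R), forall A : set (measurableTypeR R), measurable A ->
    P (X @^-1` A) = if s == 0 then \d_a A else normal_prob a s A.

Definition gaussian_field (M : Type) (T : M -> {RV P >-> R}) : Prop :=
  forall (k : nat) (m : 'I_k -> M) (a : 'I_k -> R),
    gaussian (fun w => \sum_(i < k) a i * T (m i) w).

Context {M : ptopologicalType}.
Variable mu : {finite_measure set (borel M) -> \bar R}.

Record field_conditions (T : M -> {RV P >-> R}) : Prop := {
  field_continuous : {ae P, forall w, continuous (fun m => T m w)};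
  field_centered : forall m, ('E_P[T m] = 0)%E;
  field_L2 : (\int[P]_w \int[mu]_m ((T m w) ^+ 2)%:E < +oo)%E;
  field_covariance : continuous
    (fun z : M * M => fine 'E_P[fun w => (T z.1 w * T z.2 w)%R])
}.

(* A curve t |-> u t in L^2(dP (x) dmu), t >= 0, continuous at t = 0, with
   u 0 = T, differentiable in L^2(dP (x) dmu) at every t > 0, and whose
   derivative at t is, for almost every w, the value of D at u t (w, .). *)
Definition is_solution (lambda : nat -> R) (phi : nat -> M -> R)
    (nu : {measure set (measurableTypeR R) -> \bar R})
    (T : M -> Omega -> R) (u : R -> Omega * borel M -> R) : Prop :=
  [/\ forall t, 0 <= t -> L2 (P \x mu)%E (u t),
      {ae (P \x mu)%E, forall z, u 0 z = T z.2 z.1},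
      L2dist (P \x mu)%E (u t) (u 0) @[t --> 0^'+] --> 0%E &
      forall t, 0 < t -> exists du : Omega * borel M -> R,
        [/\ L2 (P \x mu)%E du,
            L2dist (P \x mu)%E (fun z => h^-1 * (u (t + h) z - u t z)) du
              @[h --> 0^'] --> 0%E &
            {ae P, forall w, subordinate_gen mu lambda phi nu
              (fun m => u t (w, m)) (fun m => du (w, m))}]].

End random_field.

Arguments gaussian {d Omega R} P X.
Arguments gaussian_field {d Omega R} P {M} T.
Arguments field_conditions {d Omega R} P {M} mu T.
Arguments is_solution {d Omega R} P {M} mu lambda phi nu T u.

(* Main.v *)
Require Import Defs.
From mathcomp Require Import all_boot all_order all_algebra.
From mathcomp Require Import all_classical all_reals all_analysis.
From mathcomp Require Import measurable_realfun ring lra.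
Import Order.TTheory GRing.Theory Num.Theory.
Import numFieldNormedType.Exports.
Local Open Scope classical_set_scope.
Local Open Scope ring_scope.

(** In the eigenbasis everything is diagonal. The operator D acts on a function
through its coefficients: for f and h in L^2, h = D f exactly when
h_k = - Psi(lambda_k) f_k for all k ([subordinate_gen_coef] and
[subordinate_gen_of_coef]), so that the equation splits into the scalar
equations y' = - Psi(lambda_k) y with initial values c_k, one for each
eigenfunction. The proof consists in making sense of this splitting in L^2(dP (x) dmu).

Existence. The field expands as the orthogonal series of the c_j phi_j
([tensor_expansion]), and the candidate solution multiplies its terms by
e^(- t Psi(lambda_j)). Such bounded multipliers act on orthogonal series, with
norm at most their supremum ([multiplier_exists], [multiplier_normsq_le]), by
Riesz-Fischer ([L2_complete]). Continuity at 0 is strong convergence of the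
multipliers ([multiplier_cvg0]); differentiability at t > 0 holds because the
second-order remainder of e^(- t y) in t is bounded uniformly in y >= 0
([semigroup_quotient_remainder]).

Uniqueness. For a solution u, a variable q in L^2(dP) and an index k, the scalar
f(t) = <u_t, q (x) phi_k> solves f' = - Psi(lambda_k) f on t > 0 and is right-continuous
at 0, hence f(t) = e^(- t Psi(lambda_k)) f(0). The functions q (x) phi_k are total in
L^2(dP (x) dmu) ([tensor_total]), so u_t is the candidate.

Measurability. All this requires a field that is jointly measurable in the point
and the outcome. Path continuity provides one after modification on a null set
([measurable_version]): the manifold is covered by countably many charts, and
rounding the coordinates in these charts approximates the field by fields that
are constant in the point on countably many Borel cells. The coefficients
c_j of the original field agree with measurable ones off a null set only, and
may fail to be measurable themselves; the norms in which they occur are then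
lower integrals, which ignore null sets as well
([ge0_lower_integral_off_null]). *)

Set Implicit Arguments.
Unset Strict Implicit.
Unset Printing Implicit Defensive.

(** * L^2 as a pre-Hilbert space *)

Section L2_algebra.
Context {d : measure_display} {X : measurableType d} {R : realType}.
Variable mu : {measure set X -> \bar R}.
Implicit Types f g h q : X -> R.

Lemma L2P f : L2 mu f <->
  measurable_fun setT f /\ mu.-integrable setT (fun x => (f x * f x)%:E).
Proof.
split=> [Lf|[mf /integrableP[_ If]]].
  split; first by move: Lf => /andP[]; rewrite inE.
  by have /Lfun1_integrable := Lfun2_mul_Lfun1 Lf Lf.
apply/andP; split; rewrite inE //=.
rewrite /finite_norm unlock poweR_lty//.
under eq_integral => x _.
  rewrite abse_EFin poweR_EFin powR_mulrn// -normrX expr2. over.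
exact: If.
Qed.

Lemma L2_measurable f : L2 mu f -> measurable_fun setT f.
Proof. by move=> /L2P[]. Qed.

Lemma L2_mul_integrable f g : L2 mu f -> L2 mu g ->
  mu.-integrable setT (fun x => (f x * g x)%:E).
Proof. by move=> Lf Lg; have /Lfun1_integrable := Lfun2_mul_Lfun1 Lf Lg. Qed.

Lemma L2_lin f g (a : R) : L2 mu f -> L2 mu g -> L2 mu (fun x => a * f x + g x).
Proof.
move=> Lf Lg; have p1 : (1 <= 2%:E :> \bar R)%E by rewrite lee_fin ler1n.
exact: (Lfun_submod_closed mu p1).2 a f g Lf Lg.
Qed.

Lemma L2_0 : L2 mu (fun=> 0).
Proof.
apply/L2P; split => //.
by under eq_fun do rewrite mulr0; exact: integrable0.
Qed.

Lemma L2Z f (a : R) : L2 mu f -> L2 mu (fun x => a * f x).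
Proof.
move=> Lf; have := L2_lin a Lf L2_0; congr L2.
by apply/funext => x; rewrite addr0.
Qed.

Lemma L2D f g : L2 mu f -> L2 mu g -> L2 mu (fun x => f x + g x).
Proof.
move=> Lf Lg; have := L2_lin 1 Lf Lg; congr L2.
by apply/funext => x; rewrite mul1r.
Qed.

Lemma L2B f g : L2 mu f -> L2 mu g -> L2 mu (fun x => f x - g x).
Proof.
move=> Lf Lg; have := L2_lin (- 1) Lg Lf; congr L2.
by apply/funext => x; rewrite mulN1r addrC.
Qed.

Lemma L2_sumr (I : Type) (s : seq I) (p : pred I) (a : I -> X -> R) :
  (forall j, L2 mu (a j)) -> L2 mu (fun x => \sum_(j <- s | p j) a j x).
Proof.
move=> La; elim: s => [|j s ih].
  by under eq_fun do rewrite big_nil; exact: L2_0.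
under eq_fun do rewrite big_cons.
by case: (p j) => //; exact: L2D.
Qed.

Lemma innerC f g : L2_inner mu f g = L2_inner mu g f.
Proof. by apply: eq_Rintegral => x _; rewrite mulrC. Qed.

Lemma innerDl f g h : L2 mu f -> L2 mu g -> L2 mu h ->
  L2_inner mu (fun x => f x + g x) h = L2_inner mu f h + L2_inner mu g h.
Proof.
move=> Lf Lg Lh; rewrite /L2_inner -RintegralD//; try exact: L2_mul_integrable.
by apply: eq_Rintegral => x _; rewrite mulrDl.
Qed.

Lemma innerZl a f h : L2 mu f -> L2 mu h ->
  L2_inner mu (fun x => a * f x) h = a * L2_inner mu f h.
Proof.
move=> Lf Lh; rewrite /L2_inner -RintegralZl//; try exact: L2_mul_integrable.
by apply: eq_Rintegral => x _; rewrite mulrA.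
Qed.

Lemma innerBl f g h : L2 mu f -> L2 mu g -> L2 mu h ->
  L2_inner mu (fun x => f x - g x) h = L2_inner mu f h - L2_inner mu g h.
Proof.
move=> Lf Lg Lh; rewrite /L2_inner -RintegralB//; try exact: L2_mul_integrable.
by apply: eq_Rintegral => x _; rewrite mulrBl.
Qed.

Lemma inner0l h : L2_inner mu (fun=> 0) h = 0.
Proof.
by rewrite /L2_inner /Rintegral; under eq_integral do rewrite mul0r; rewrite integral0.
Qed.

Lemma inner_suml (I : Type) (s : seq I) (p : pred I) (a : I -> X -> R) h :
  (forall j, L2 mu (a j)) -> L2 mu h ->
  L2_inner mu (fun x => \sum_(j <- s | p j) a j x) h =
  \sum_(j <- s | p j) L2_inner mu (a j) h.
Proof.
move=> La Lh; elim: s => [|j s ih].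
  rewrite big_nil; under [X in L2_inner mu X _]eq_fun do rewrite big_nil.
  exact: inner0l.
rewrite big_cons -ih; case: ifPn => pj.
  rewrite -innerDl//; last exact: L2_sumr.
  by congr L2_inner; apply/funext => x; rewrite big_cons pj.
by congr L2_inner; apply/funext => x; rewrite big_cons (negbTE pj).
Qed.

Lemma normsq_ge0 f : 0 <= L2_inner mu f f.
Proof. by apply: Rintegral_ge0 => x _; rewrite -expr2 sqr_ge0. Qed.

Lemma EFin_inner f g : L2 mu f -> L2 mu g ->
  ((L2_inner mu f g)%:E = \int[mu]_x (f x * g x)%:E)%E.
Proof.
move=> Lf Lg; rewrite fineK//; apply: integrable_fin_num => //.
exact: L2_mul_integrable.
Qed.

Lemma L2distE f g : L2 mu f -> L2 mu g ->
  L2dist mu f g =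
  (Num.sqrt (L2_inner mu (fun x => f x - g x) (fun x => f x - g x)))%:E.
Proof.
move=> Lf Lg; have Lfg := L2B Lf Lg.
rewrite /L2dist unlock.
under eq_integral => x _.
  rewrite abse_EFin poweR_EFin powR_mulrn// -normrX ger0_norm ?sqr_ge0// expr2.
  over.
by rewrite -EFin_inner// poweR_EFin powR12_sqrt// normsq_ge0.
Qed.

Lemma normsqB f g : L2 mu f -> L2 mu g ->
  L2_inner mu (fun x => f x - g x) (fun x => f x - g x) =
  L2_inner mu f f - 2 * L2_inner mu f g + L2_inner mu g g.
Proof.
move=> Lf Lg; have Lfg := L2B Lf Lg.
rewrite (innerBl Lf Lg Lfg) (innerC f) (innerC g) !innerBl// (innerC g f).
by ring.
Qed.

Lemma normsqZ a f : L2 mu f ->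
  L2_inner mu (fun x => a * f x) (fun x => a * f x) = a ^+ 2 * L2_inner mu f f.
Proof.
move=> Lf; have Laf := L2Z a Lf.
by rewrite (innerZl a Lf Laf) innerC innerZl// mulrA expr2.
Qed.

Lemma cauchy_schwarz f g : L2 mu f -> L2 mu g ->
  (L2_inner mu f g) ^+ 2 <= L2_inner mu f f * L2_inner mu g g.
Proof.
move=> Lf Lg.
set A := L2_inner mu f f; set B := L2_inner mu f g; set C := L2_inner mu g g.
have A0 : 0 <= A by exact: normsq_ge0.
have C0 : 0 <= C by exact: normsq_ge0.
have key (t : R) : 0 <= A - 2 * t * B + t ^+ 2 * C.
  have Ltg := L2Z t Lg.
  have := normsq_ge0 (fun x => f x - t * g x).
  rewrite normsqB// normsqZ// (innerC f) innerZl// (innerC g f) -/A -/B -/C.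
  by rewrite mulrA.
have [C00|C0'] := eqVneq C 0.
  rewrite C00 mulr0; suff -> : B = 0 by rewrite expr0n.
  apply/eqP; apply: contraT => B0.
  (* For this t the quadratic A - 2 t B takes the value -1, so B = 0. *)
  have := key ((A + 1) / (2 * B)); rewrite C00 mulr0 addr0.
  have -> : A - 2 * ((A + 1) / (2 * B)) * B = -1 by field.
  by lra.
have Cp : 0 < C by rewrite lt_neqAle eq_sym C0' C0.
(* The minimum of t |-> |f - t g|^2 is attained at t = B / C. *)
have := key (B / C).
have -> : A - 2 * (B / C) * B + (B / C) ^+ 2 * C = (A * C - B ^+ 2) / C by field.
by rewrite pmulr_lge0 ?invr_gt0// subr_ge0.
Qed.
End L2_algebra.

(** * Almost everywhere equality and limits in L^2 *)

Section L2_limits.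
Context {d : measure_display} {X : measurableType d} {R : realType}.
Variable mu : {measure set X -> \bar R}.
Implicit Types f g h q : X -> R.

Lemma L2_ae f g : measurable_fun setT g -> {ae mu, forall x, f x = g x} ->
  L2 mu f -> L2 mu g.
Proof.
move=> mg fg /L2P[mf /integrableP[mff iff]]; apply/L2P; split => //.
have mgg : measurable_fun setT (EFin \o (fun x => g x * g x)).
  by apply/measurable_EFinP; exact: measurable_funM.
apply/integrableP; split => //; apply: le_lt_trans iff.
apply: ae_ge0_le_integral => //.
- exact: (measurableT_comp (@abse_measurable R setT) mgg).
- exact: (measurableT_comp (@abse_measurable R setT) mff).
by apply: filterS fg => x -> _.
Qed.

Lemma inner_ae f g h : measurable_fun setT f -> measurable_fun setT g ->
  measurable_fun setT h -> {ae mu, forall x, f x = g x} ->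
  L2_inner mu f h = L2_inner mu g h.
Proof.
move=> mf mg mh fg; congr fine; apply: ae_eq_integral => //.
- by apply/measurable_EFinP; exact: measurable_funM.
- by apply/measurable_EFinP; exact: measurable_funM.
by apply: filterS fg => x -> _.
Qed.

Lemma normsq0_ae f : L2 mu f -> L2_inner mu f f = 0 -> {ae mu, forall x, f x = 0}.
Proof.
move=> Lf f0; have mf := L2_measurable Lf.
have : (\int[mu]_x `|(f x * f x)%:E| = 0)%E.
  under eq_integral do rewrite gee0_abs ?lee_fin -?expr2 ?sqr_ge0// expr2.
  by rewrite -EFin_inner// f0.
move/ae_eq_integral_abs => -/(_ measurableT) [].
  by apply/measurable_EFinP; exact: measurable_funM.
move=> N [mN N0 sub]; exists N; split => // x /= fx; apply: sub => /= h.
by apply: fx; have /= [/eqP] := h I; rewrite mulf_eq0 orbb => /eqP.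
Qed.

Section limits.
Context {I : Type} {F : set_system I} {FF : Filter F}.

(** Convergence for the extended-real L^2 norm is the same as convergence to 0
of the real number |f_i - g|^2, which is bilinear in its arguments; all the
limits below are computed in the second form. *)
Lemma L2dist_cvgP (f : I -> X -> R) g :
  (\forall i \near F, L2 mu (f i)) -> L2 mu g ->
  (L2dist mu (f i) g @[i --> F] --> 0%E) <->
  (L2_inner mu (fun x => f i x - g x) (fun x => f i x - g x) @[i --> F] --> 0).
Proof.
move=> Lf Lg; set s := fun i => L2_inner mu _ _.
have E : \forall i \near F, L2dist mu (f i) g = (Num.sqrt (s i))%:E.
  by apply: filterS Lf => i Lfi; rewrite L2distE.
have E' : \forall i \near F, (Num.sqrt (s i))%:E = L2dist mu (f i) g.
  by apply: filterS E.
split=> [h|h].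
  have : (Num.sqrt (s i))%:E @[i --> F] --> 0%:E.
    by apply: cvg_trans h; exact: near_eq_cvg.
  move=> /fine_cvg /= sq.
  have -> : s = fun i => Num.sqrt (s i) * Num.sqrt (s i).
    by apply/funext => i; rewrite -expr2 sqr_sqrtr// normsq_ge0.
  by rewrite -[X in _ --> X](mulr0 0); exact: cvgM.
apply: (@cvg_trans _ ((Num.sqrt (s i))%:E @[i --> F])).
  exact: near_eq_cvg.
apply: cvg_EFin; first exact: nearW.
rewrite -[X in _ --> X]sqrtr0.
exact: (cvg_comp _ _ h (@sqrt_continuous R 0)).
Qed.

Lemma inner_cvg (f : I -> X -> R) g q :
  (\forall i \near F, L2 mu (f i)) -> L2 mu g -> L2 mu q ->
  (L2_inner mu (fun x => f i x - g x) (fun x => f i x - g x) @[i --> F] --> 0) ->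
  L2_inner mu (f i) q @[i --> F] --> L2_inner mu g q.
Proof.
move=> Lf Lg Lq h; apply/subr_cvg0/norm_cvg0P.
set s := fun i => L2_inner mu _ _ in h.
have b0 : Num.sqrt (s i * L2_inner mu q q) @[i --> F] --> 0.
  have /(cvg_comp _ _) : s i * L2_inner mu q q @[i --> F] --> 0.
    by rewrite -[X in _ --> X](mul0r (L2_inner mu q q)); exact: cvgMr_tmp.
  by move=> /(_ _ _ _ (@sqrt_continuous R 0)); rewrite sqrtr0.
apply: (squeeze_cvgr _ (cvg_cst 0) b0).
apply: filterS Lf => i Lfi; rewrite normr_ge0 /= -innerBl// -sqrtr_sqr.
by rewrite ler_wsqrtr//; apply: cauchy_schwarz => //; exact: L2B.
Qed.

End limits.

End L2_limits.

(** * Completeness of L^2 *)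

Section L2_completeness.
Context {d : measure_display} {X : measurableType d} {R : realType}.
Variable mu : {measure set X -> \bar R}.
Implicit Types f g h q : X -> R.

Lemma limn_einf_le (a : nat -> \bar R) (e : \bar R) :
  (\forall n \near \oo, a n <= e)%E -> (limn_einf a <= e)%E.
Proof.
move=> [N _ ae]; rewrite limn_einf_lim; apply: lime_le; first exact: is_cvg_einfs.
apply: nearW => n; apply: (@le_trans _ _ (a (n + N)%N)).
  by apply: ereal_inf_lbound; exists (n + N)%N => //=; exact: leq_addr.
by apply: ae => /=; exact: leq_addl.
Qed.

(** From (t y - 1/2)^2 >= 0. With t = 2 ^ i, it bounds the increments of a
sequence by a geometric series plus their weighted squares. *)
Lemma le_inv_add_sqr (y t : R) : 0 < t -> y <= t^-1 + t * y ^+ 2.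
Proof.
move=> t0; have tV : 0 < t^-1 by rewrite invr_gt0.
have : 0 <= t^-1 * ((t * y - 2^-1) ^+ 2) by rewrite mulr_ge0 ?sqr_ge0// ltW.
have -> : t^-1 * ((t * y - 2^-1) ^+ 2) = t * y ^+ 2 - y + t^-1 * 4^-1.
  by field; lra.
by lra.
Qed.

Lemma summable_increments_cvg (v : nat -> R) :
  (\sum_(i <oo) ((2 ^+ i * (v i.+1 - v i) ^+ 2)%:E) < +oo)%E -> cvgn v.
Proof.
move=> fin.
have c1 : cvgn (series (fun i => 2 ^+ i * (v i.+1 - v i) ^+ 2)).
  by apply: nnseries_is_cvg => // i; rewrite mulr_ge0 ?sqr_ge0// exprn_ge0.
have c2 : cvgn (series (geometric 1 (2^-1 : R))).
  by apply: is_cvg_geometric_series; rewrite ger0_norm ?invr_ge0// invf_lt1// ltr1n.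
have : cvgn (series (fun i => v i.+1 - v i)).
  apply: normed_cvg.
  apply: (@series_le_cvg _ _ ((geometric 1 2^-1) +
     (fun i => 2 ^+ i * (v i.+1 - v i) ^+ 2))) => [i|i|i|] /=.
  - exact: normr_ge0.
  - by apply: addr_ge0; apply: mulr_ge0; rewrite ?sqr_ge0 ?exprn_ge0 ?invr_ge0.
  - have := @le_inv_add_sqr `|v i.+1 - v i| (2 ^+ i) (exprn_gt0 i (ltr0Sn R 1)).
    by rewrite (real_normK (num_real _)) -exprVn -(mul1r (2^-1 ^+ i)).
  - by rewrite seriesD; exact: is_cvgD.
move=> cD; have -> : v = fun n => v 0%N + series (fun i => v i.+1 - v i) n.
  by apply/funext => n; rewrite /series /= telescope_sumr// addrC subrK.
by apply: is_cvgD => //; exact: is_cvg_cst.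
Qed.

(** The weights 2 ^ i are small enough for the sum of the 2 ^ i |v_{i+1} - v_i|^2
to have a finite integral (at most the sum of the 2 ^ -i), hence to be finite
almost everywhere, and large enough for this to make the increments
absolutely summable. Working with squares avoids any use of the triangle
inequality in L^2. *)
Lemma L2_fast_cauchy_ae_cvg (v : nat -> X -> R) :
  (forall n, L2 mu (v n)) ->
  (forall i, L2_inner mu (fun x => v i.+1 x - v i x) (fun x => v i.+1 x - v i x)
     <= 4^-1 ^+ i) ->
  {ae mu, forall x, cvgn (v ^~ x)}.
Proof.
move=> Lv fast; pose D i x := (v i.+1 x - v i x).
have LD i : L2 mu (D i) by exact: L2B.
pose G x := (\sum_(i <oo) (2 ^+ i * D i x ^+ 2)%:E)%E.
have mF i : measurable_fun setT (fun x => (2 ^+ i * D i x ^+ 2)%:E).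
  apply/measurable_EFinP; apply: measurable_funM => //.
  by apply: measurable_funX; exact: L2_measurable (LD i).
have F0 i x : setT x -> (0 <= (2 ^+ i * D i x ^+ 2)%:E)%E.
  by move=> _; rewrite lee_fin mulr_ge0 ?sqr_ge0// exprn_ge0.
have G0 x : (0 <= G x)%E by apply: nneseries_ge0 => i _ _; exact: F0.
have iG : mu.-integrable setT G.
  apply/integrableP; split.
    by apply: ge0_emeasurable_sum => // k x _ _; exact: F0.
  under eq_integral do rewrite gee0_abs ?G0//.
  rewrite integral_nneseries//.
  apply: (@le_lt_trans _ _ (\sum_(i <oo) (2 / (2 ^ (i + 1))%:R)%:E)%E).
    apply: lee_nneseries => [i _ _|i _]; first by apply: integral_ge0 => x; exact: F0.
    have -> : (\int[mu]_x (2 ^+ i * D i x ^+ 2)%:E =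
        (2 ^+ i * L2_inner mu (D i) (D i))%:E)%E.
      under eq_integral do rewrite EFinM expr2.
      by rewrite integralZl//; [rewrite -EFin_inner|exact: L2_mul_integrable].
    have -> : 2 / (2 ^ (i + 1))%:R = 2 ^+ i * 4^-1 ^+ i :> R.
      rewrite natrX addn1 exprS exprVn (_ : 4 = 2 * 2 :> R); last by ring.
      by rewrite exprMn; field; rewrite expf_neq0.
    by rewrite lee_fin ler_pM2l ?exprn_gt0//; exact: fast.
  by rewrite (cvg_lim _ (@cvg_geometric_eseries_half R 2 0))// ltry.
have := integrable_ae measurableT iG; apply: filterS => x /(_ I) Gx.
apply: summable_increments_cvg; rewrite -/(G x).
by rewrite -ge0_fin_numE.
Qed.

(** Riesz-Fischer. A subsequence whose increments decrease fast converges almost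
everywhere; by Fatou's lemma its pointwise limit is also the L^2 limit of the
whole sequence. *)
Theorem L2_complete (u : nat -> X -> R) : (forall n, L2 mu (u n)) ->
  (forall e, 0 < e -> exists N, forall m n, (N <= m)%N -> (N <= n)%N ->
     L2_inner mu (fun x => u m x - u n x) (fun x => u m x - u n x) <= e) ->
  exists f, L2 mu f /\
    L2_inner mu (fun x => u n x - f x) (fun x => u n x - f x) @[n --> \oo] --> 0.
Proof.
move=> Lu cauchy_u.
have /choice[N HN] : forall i, exists N, forall m n, (N <= m)%N -> (N <= n)%N ->
    L2_inner mu (fun x => u m x - u n x) (fun x => u m x - u n x) <= 4^-1 ^+ i.
  by move=> i; apply: cauchy_u; rewrite exprn_gt0// invr_gt0.
(* The term + i forces k to tend to infinity; the sum makes it nondecreasing. *)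
pose k i := (\sum_(j < i.+1) N j + i)%N.
have Nk i : (N i <= k i)%N by rewrite /k big_ord_recr/= -addnA addnCA leq_addr.
have kS i : (k i <= k i.+1)%N.
  by rewrite /k [X in (_ <= X + _)%N]big_ord_recr/= leq_add// leq_addr.
have ki i : (i <= k i)%N by rewrite leq_addl.
have [Z [mZ Z0 cvgZ]] : {ae mu, forall x, cvgn (fun i => u (k i) x)}.
  apply: (@L2_fast_cauchy_ae_cvg (fun i => u (k i))) => // i.
  by apply: HN => //; apply: leq_trans (kS i); exact: Nk.
(* Killing the subsequence on the null set Z makes it converge everywhere, so that
   its limit is measurable. *)
pose w i x := u (k i) x * \1_(~` Z) x.
have wE i : {ae mu, forall x, w i x = u (k i) x}.
  exists Z; split => // x /= wx; apply: contrapT => Zx; apply: wx.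
  by rewrite /w indicE mem_set// mulr1.
have mw i : measurable_fun setT (w i).
  apply: measurable_funM; first exact: L2_measurable (Lu _).
  by apply: measurable_indic; exact: measurableC.
have Lw i : L2 mu (w i).
  apply: L2_ae (Lu (k i)) => //.
  by apply: filterS (wE i) => x ->.
have cw x : cvgn (w ^~ x).
  have [Zx|Zx] := pselect (Z x).
    rewrite /w indicE memNset; last by apply.
    by under eq_fun do rewrite mulr0; exact: is_cvg_cst.
  rewrite /w indicE mem_set//; under eq_fun do rewrite mulr1.
  by apply: contrapT => h; apply: Zx; exact: cvgZ.
pose f x := limn (w ^~ x).
have mf : measurable_fun setT f.
  by apply: measurable_fun_cvg mw _ => x _; exact: cw.
have bound e : 0 < e -> exists N, forall n, (N <= n)%N ->
    (\int[mu]_x ((u n x - f x) * (u n x - f x))%:E <= e%:E)%E.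
  move=> /cauchy_u[M HM]; exists M => n Mn.
  have -> : (\int[mu]_x ((u n x - f x) * (u n x - f x))%:E =
     \int[mu]_x (limn_einf (fun i => ((u n x - w i x) * (u n x - w i x))%:E)))%E.
    apply: eq_integral => x _; apply/esym.
    have h : u n x - w i x @[i --> \oo] --> u n x - f x.
      by apply: cvgB; [exact: cvg_cst|exact: cw].
    have : ((u n x - w i x) * (u n x - w i x))%:E @[i --> \oo] -->
        ((u n x - f x) * (u n x - f x))%:E.
      by apply: cvg_EFin; [exact: nearW|exact: cvgM].
    by move=> /cvg_limn_einf_sup[].
  apply: le_trans; first apply: fatou => //.
  - move=> i; apply/measurable_EFinP; apply: measurable_funM;
      by apply: measurable_funB => //; exact: L2_measurable (Lu n).
  - by move=> i x _; rewrite lee_fin -expr2 sqr_ge0.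
  apply: limn_einf_le; exists M => // i /= Mi.
  rewrite -EFin_inner ?lee_fin; [|exact: L2B|exact: L2B].
  have : L2_inner mu (fun x => u n x - u (k i) x) (fun x => u n x - u (k i) x) <= e.
    by apply: HM => //; exact: leq_trans (ki i).
  congr (_ <= _).
  have h : {ae mu, forall x, u n x - u (k i) x = u n x - w i x}.
    by apply: filterS (wE i) => x ->.
  have mun j : measurable_fun setT (fun x => u n x - u (k j) x).
    by apply: measurable_funB; exact: L2_measurable (Lu _).
  have mwn j : measurable_fun setT (fun x => u n x - w j x).
    by apply: measurable_funB => //; exact: L2_measurable (Lu _).
  by rewrite (inner_ae _ _ _ h)// innerC (inner_ae _ _ _ h).
have Luf : exists n, L2 mu (fun x => u n x - f x).
  have [M HM] := bound 1 ltr01; exists M; apply/L2P.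
  have mM : measurable_fun setT (fun x => u M x - f x).
    by apply: measurable_funB => //; exact: L2_measurable (Lu M).
  split => //; apply/integrableP; split.
    by apply/measurable_EFinP; exact: measurable_funM.
  under eq_integral do rewrite gee0_abs ?lee_fin -?expr2 ?sqr_ge0// expr2.
  by apply: le_lt_trans (HM M (leqnn M)) _; exact: ltry.
have Lf : L2 mu f.
  have [n Ln] := Luf; have := L2B (Lu n) Ln; congr L2.
  by apply/funext => x; rewrite subKr.
exists f; split => //; apply/cvgrPdist_le => e e0.
have [M HM] := bound e e0; exists M => // n /= Mn.
rewrite sub0r normrN ger0_norm ?normsq_ge0// -lee_fin EFin_inner; try exact: L2B.
exact: HM.
Qed.

End L2_completeness.

(** * Orthogonal series and multipliers *)

Section orthogonal_series.
Context {d : measure_display} {X : measurableType d} {R : realType}.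
Variable mu : {measure set X -> \bar R}.
Implicit Types (f g h q : X -> R) (a b : nat -> X -> R).

Lemma L2_psum a N : (forall j, L2 mu (a j)) ->
  L2 mu (fun x => \sum_(j < N) a j x).
Proof. by move=> La; apply: (@L2_sumr _ _ _ _ _ _ _ (fun j : 'I_N => a j)). Qed.

Lemma inner_psuml a N q : (forall j, L2 mu (a j)) -> L2 mu q ->
  L2_inner mu (fun x => \sum_(j < N) a j x) q = \sum_(j < N) L2_inner mu (a j) q.
Proof.
by move=> La Lq; rewrite (@inner_suml _ _ _ _ _ _ _ (fun j : 'I_N => a j)).
Qed.

Lemma L2_sumP a f : (forall j, L2 mu (a j)) -> L2_sum mu a f <->
  L2 mu f /\ L2_inner mu (fun x => \sum_(j < N) a j x - f x)
                         (fun x => \sum_(j < N) a j x - f x) @[N --> \oo] --> 0.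
Proof.
move=> La; have LS N := L2_psum N La.
split=> -[Lf h]; split => //.
  by apply/(L2dist_cvgP (f := fun N x => \sum_(j < N) a j x)) => //; exact: nearW.
by apply/(L2dist_cvgP (f := fun N x => \sum_(j < N) a j x)) => //; exact: nearW.
Qed.

Lemma L2_sum_inner a f q : (forall j, L2 mu (a j)) -> L2_sum mu a f -> L2 mu q ->
  \sum_(j < N) L2_inner mu (a j) q @[N --> \oo] --> L2_inner mu f q.
Proof.
move=> La /(L2_sumP f La)[Lf h] Lq.
under eq_fun do rewrite -inner_psuml//.
apply: (inner_cvg (f := fun N x => \sum_(j < N) a j x)) => //.
by apply: nearW => N; exact: L2_psum.
Qed.

(** Both sums have the same inner product with their difference, which is
therefore orthogonal to itself. *)
Lemma L2_sum_unique a f g : (forall j, L2 mu (a j)) ->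
  L2_sum mu a f -> L2_sum mu a g -> {ae mu, forall x, f x = g x}.
Proof.
move=> La Sf Sg; have Lf := Sf.1; have Lg := Sg.1; have Lfg := L2B Lf Lg.
suff : {ae mu, forall x, f x - g x = 0}.
  by apply: filterS => x /eqP; rewrite subr_eq0 => /eqP.
apply: normsq0_ae => //; rewrite innerBl//; apply/eqP; rewrite subr_eq0; apply/eqP.
exact: (cvg_unique _ (L2_sum_inner La Sf Lfg) (L2_sum_inner La Sg Lfg)).
Qed.

Lemma L2_sum_ae a f g : (forall j, L2 mu (a j)) -> measurable_fun setT g ->
  {ae mu, forall x, f x = g x} -> L2_sum mu a f -> L2_sum mu a g.
Proof.
move=> La mg fg Sf; have Lf := Sf.1; have Lg := L2_ae mg fg Lf.
apply/(L2_sumP g La); split => //; move: Sf => /(L2_sumP f La)[_].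
apply: cvg_trans; apply: near_eq_cvg; apply: nearW => N.
have LS := L2_psum N La.
have [mF mG] := (L2_measurable (L2B LS Lf), L2_measurable (L2B LS Lg)).
have h : {ae mu, forall x, \sum_(j < N) a j x - g x = \sum_(j < N) a j x - f x}.
  by apply: filterS fg => x ->.
by rewrite (inner_ae mG mF mG h) innerC (inner_ae mG mF mF h).
Qed.

Lemma L2_sum_lin c a b f g :
  (forall j, L2 mu (a j)) -> (forall j, L2 mu (b j)) ->
  L2_sum mu a f -> L2_sum mu b g ->
  L2_sum mu (fun j x => c * a j x + b j x) (fun x => c * f x + g x).
Proof.
move=> La Lb /(L2_sumP f La)[Lf hf] /(L2_sumP g Lb)[Lg hg].
have Lab j : L2 mu (fun x => c * a j x + b j x) by exact: L2_lin.
apply/(L2_sumP _ Lab); split; first exact: L2_lin.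
set s := fun N => L2_inner mu _ _ in hf; set t := fun N => L2_inner mu _ _ in hg.
have h0 : 2 * (c ^+ 2 * s N) + 2 * t N @[N --> \oo] --> 0.
  have -> : 0 = 2 * (c ^+ 2 * 0) + 2 * 0 :> R by ring.
  by apply: cvgD; apply: cvgMl_tmp => //; exact: cvgMl_tmp.
apply: (squeeze_cvgr _ (cvg_cst 0) h0); apply: nearW => N.
rewrite normsq_ge0 /=.
pose F x := \sum_(j < N) a j x - f x; pose G x := \sum_(j < N) b j x - g x.
have LF : L2 mu F by apply: L2B => //; exact: L2_psum.
have LG : L2 mu G by apply: L2B => //; exact: L2_psum.
have LcF := L2Z c LF.
have -> : (fun x => \sum_(j < N) (c * a j x + b j x) - (c * f x + g x)) =
   (fun x => c * F x + G x).
  by apply/funext => x; rewrite big_split/= -mulr_sumr /F /G; ring.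
rewrite -/(s N) -/(t N) /s /t -/F -/G -normsqZ//.
have LFG := L2D LcF LG; have LFG' := L2B LcF LG.
have := normsq_ge0 mu (fun x => c * F x - G x); rewrite normsqB//.
have -> : L2_inner mu (fun x => c * F x + G x) (fun x => c * F x + G x) =
    L2_inner mu (fun x => c * F x) (fun x => c * F x) +
    2 * L2_inner mu (fun x => c * F x) G + L2_inner mu G G.
  rewrite (innerDl LcF LG LFG) [X in X + _]innerC [X in _ + X]innerC.
  rewrite (innerDl LcF LG LcF) (innerDl LcF LG LG) (innerC mu G (fun x => c * F x)).
  by ring.
by lra.
Qed.

Lemma L2_sumB a b f g :
  (forall j, L2 mu (a j)) -> (forall j, L2 mu (b j)) ->
  L2_sum mu a f -> L2_sum mu b g ->
  L2_sum mu (fun j x => a j x - b j x) (fun x => f x - g x).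
Proof.
move=> La Lb Sf Sg; have := L2_sum_lin (- 1) Lb La Sg Sf.
by congr L2_sum; [apply/funext => j|]; apply/funext => x; rewrite mulN1r addrC.
Qed.

Lemma L2_sumZ c a f : (forall j, L2 mu (a j)) -> L2_sum mu a f ->
  L2_sum mu (fun j x => c * a j x) (fun x => c * f x).
Proof.
move=> La Sf; have := L2_sum_lin (c - 1) La La Sf Sf.
by congr L2_sum; [apply/funext => j|]; apply/funext => x; ring.
Qed.

(** Pythagoras. *)
Lemma normsq_sum a (s : seq nat) : (forall j, L2 mu (a j)) ->
  (forall j k, j != k -> L2_inner mu (a j) (a k) = 0) -> uniq s ->
  L2_inner mu (fun x => \sum_(j <- s) a j x) (fun x => \sum_(j <- s) a j x) =
  \sum_(j <- s) L2_inner mu (a j) (a j).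
Proof.
move=> La orth us; have LS := L2_sumr s xpredT La.
rewrite inner_suml//; apply: eq_big_seq => j js.
rewrite innerC inner_suml// (bigD1_seq j)//= big1 ?addr0// => k kj.
exact: orth.
Qed.

Lemma cvg_tail_sum (s : nat -> R) : cvgn (series s) -> forall e, 0 < e ->
  exists N, forall m n, (N <= m)%N -> (N <= n)%N -> series s n - series s m <= e.
Proof.
move=> /cvg_ex[l sl] e e0.
have e2 : 0 < e / 2 by rewrite divr_gt0.
have /cvgrPdist_le /(_ _ e2)[N _ HN] := sl.
exists N => m n Nm Nn; have := HN m Nm; have := HN n Nn.
by rewrite /= !ler_norml => /andP[? ?] /andP[? ?]; lra.
Qed.

Lemma L2_sum_exists a : (forall j, L2 mu (a j)) ->
  (forall j k, j != k -> L2_inner mu (a j) (a k) = 0) ->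
  cvgn (series (fun j => L2_inner mu (a j) (a j))) -> exists f, L2_sum mu a f.
Proof.
move=> La orth cv.
have LS N := L2_psum N La.
have [|f [Lf hf]] := L2_complete LS; last by exists f; apply/(L2_sumP f La).
move=> e e0; have [N HN] := cvg_tail_sum cv e0; exists N.
have key m n : (N <= m)%N -> (m <= n)%N ->
  L2_inner mu (fun x => \sum_(j < n) a j x - \sum_(j < m) a j x)
              (fun x => \sum_(j < n) a j x - \sum_(j < m) a j x) <= e.
  move=> Nm mn.
  have -> : (fun x => \sum_(j < n) a j x - \sum_(j < m) a j x) =
     (fun x => \sum_(j <- index_iota m n) a j x).
    apply/funext => x; rewrite -!(big_mkord xpredT (fun j => a j x)).
    by rewrite (big_cat_nat (leq0n m) mn)/= [X in X - _]addrC addrK.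
  rewrite normsq_sum ?iota_uniq//.
  have := HN m n Nm (leq_trans Nm mn).
  by rewrite /series/= (big_cat_nat (leq0n m) mn)/= [X in X - _]addrC addrK.
move=> m n Nm Nn; have [mn|/ltnW nm] := leqP n m; first exact: key.
have := key m n Nm nm; congr (_ <= _).
have -> : (fun x => \sum_(j < n) a j x - \sum_(j < m) a j x) =
   (fun x => (-1) * (\sum_(j < m) a j x - \sum_(j < n) a j x)).
  by apply/funext => x; ring.
by rewrite normsqZ; [rewrite sqrrN expr1n mul1r|exact: L2B].
Qed.

(** The partial sums of the inner products with q are eventually constant. *)
Lemma L2_sum_coef a f q k : (forall j, L2 mu (a j)) -> L2 mu q ->
  (forall j, j != k -> L2_inner mu (a j) q = 0) ->
  L2_sum mu a f -> L2_inner mu f q = L2_inner mu (a k) q.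
Proof.
move=> La Lq orth Sf; have h := L2_sum_inner La Sf Lq.
suff h' : \sum_(j < N) L2_inner mu (a j) q @[N --> \oo] --> L2_inner mu (a k) q.
  exact: (cvg_unique _ h h').
apply: cvg_near_cst; exists k.+1 => // N /= kN.
rewrite (bigD1 (Ordinal kN))//= big1 ?addr0// => j jk; apply: orth.
by apply: contra jk => /eqP jk; apply/eqP/val_inj.
Qed.

Lemma L2_sum_normsq a f : (forall j, L2 mu (a j)) ->
  (forall j k, j != k -> L2_inner mu (a j) (a k) = 0) -> L2_sum mu a f ->
  \sum_(j < N) L2_inner mu (a j) (a j) @[N --> \oo] --> L2_inner mu f f.
Proof.
move=> La orth Sf; have Lf := Sf.1.
have := L2_sum_inner La Sf Lf.
suff E j : L2_inner mu (a j) f = L2_inner mu (a j) (a j).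
  by under eq_fun do under eq_bigr do rewrite E.
by rewrite innerC; apply: L2_sum_coef Sf => // k kj; exact: orth.
Qed.

Section multiplier.
Variables (a : nat -> X -> R) (f : X -> R).
Hypothesis La : forall j, L2 mu (a j).
Hypothesis orth : forall j k, j != k -> L2_inner mu (a j) (a k) = 0.
Hypothesis Sf : L2_sum mu a f.

Lemma multiplier_L2 (m : nat -> R) j : L2 mu (fun x => m j * a j x).
Proof. exact: L2Z. Qed.

Lemma multiplier_orth (m : nat -> R) j k : j != k ->
  L2_inner mu (fun x => m j * a j x) (fun x => m k * a k x) = 0.
Proof.
move=> jk; rewrite innerZl//; last exact: L2Z.
by rewrite innerC innerZl// innerC orth// !mulr0.
Qed.

(** A bounded diagonal operator acts on orthogonal series. The heat semigroup,
the solution of the Cauchy problem, its time derivative and the error in its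
difference quotients are all obtained by multiplying the terms of one
orthogonal series by bounded scalars, so this section is the whole operator
theory that is used. *)
Lemma multiplier_exists (m : nat -> R) (C : R) : (forall j, `|m j| <= C) ->
  exists h, L2_sum mu (fun j x => m j * a j x) h.
Proof.
move=> mC; apply: L2_sum_exists; [exact: multiplier_L2|exact: multiplier_orth|].
under eq_fun do rewrite normsqZ//.
apply: (@series_le_cvg _ _ (fun j => C ^+ 2 * L2_inner mu (a j) (a j))).
- by move=> j; rewrite mulr_ge0 ?sqr_ge0 ?normsq_ge0.
- by move=> j; rewrite mulr_ge0 ?sqr_ge0 ?normsq_ge0.
- move=> j; rewrite ler_wpM2r ?normsq_ge0// -[leLHS]real_normK ?num_real//.
  by rewrite ler_sqr ?nnegrE//; apply: le_trans (mC j).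
apply: is_cvg_seriesZ; apply/cvg_ex; exists (L2_inner mu f f).
have := L2_sum_normsq La orth Sf.
by under eq_fun do rewrite -(big_mkord xpredT (fun j => L2_inner mu (a j) (a j))).
Qed.

(** The first N terms are kept exactly, and the tail is bounded by the tail of
the original series. The case N = 0 gives the operator norm bound, large N
gives strong convergence. *)
Lemma multiplier_normsq (m : nat -> R) (N : nat) h :
  L2_sum mu (fun j x => m j * a j x) h -> (forall j, (N <= j)%N -> `|m j| <= 1) ->
  L2_inner mu h h <= \sum_(j < N) m j ^+ 2 * L2_inner mu (a j) (a j) +
    (L2_inner mu f f - \sum_(j < N) L2_inner mu (a j) (a j)).
Proof.
move=> Sh mle.
have ch := L2_sum_normsq (multiplier_L2 m) (@multiplier_orth m) Sh.
have cf := L2_sum_normsq La orth Sf.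
set r := leRHS.
have cr : \sum_(j < N) m j ^+ 2 * L2_inner mu (a j) (a j) +
   (\sum_(j < K) L2_inner mu (a j) (a j) - \sum_(j < N) L2_inner mu (a j) (a j))
   @[K --> \oo] --> r.
  by apply: cvgD; [exact: cvg_cst|apply: cvgB => //; exact: cvg_cst].
rewrite -(cvg_lim _ ch)// -(cvg_lim _ cr)//.
apply: ler_lim; [exact: cvgP ch|exact: cvgP cr|].
exists N => // K /= NK; under eq_bigr do rewrite normsqZ//.
rewrite -!(big_mkord xpredT (fun j => m j ^+ 2 * L2_inner mu (a j) (a j))).
rewrite -!(big_mkord xpredT (fun j => L2_inner mu (a j) (a j))).
rewrite !(big_cat_nat (leq0n N) NK)/= lerD2l (addrC (\sum_(0 <= i < N) _)) addrK.
rewrite [leLHS]big_nat_cond [leRHS]big_nat_cond ler_sum// => j /andP[/andP[Nj _] _].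
rewrite ler_piMl ?normsq_ge0// -[leLHS]real_normK ?num_real//.
by rewrite expr_le1// mle.
Qed.

Lemma multiplier_normsq_le (m : nat -> R) (C : R) h : 0 < C ->
  L2_sum mu (fun j x => m j * a j x) h -> (forall j, `|m j| <= C) ->
  L2_inner mu h h <= C ^+ 2 * L2_inner mu f f.
Proof.
move=> C0 Sh mC; have Lh := Sh.1.
have S' : L2_sum mu (fun j x => C^-1 * m j * a j x) (fun x => C^-1 * h x).
  have := L2_sumZ C^-1 (multiplier_L2 m) Sh; congr L2_sum.
  by apply/funext => j; apply/funext => x; rewrite mulrA.
have := @multiplier_normsq (fun j => C^-1 * m j) 0 _ S'.
rewrite !big_ord0 add0r subr0 normsqZ// exprVn ler_pdivrMl ?exprn_gt0//; apply.
by move=> j _; rewrite normrM gtr0_norm ?invr_gt0// ler_pdivrMl// mulr1.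
Qed.

(** Dominated convergence for multipliers: they tend to 0 one index at a time,
while the tail of the series is uniformly small. *)
Lemma multiplier_cvg0 {I : Type} {F : set_system I} {FF : Filter F}
    (m : I -> nat -> R) (h : I -> X -> R) :
  (\forall i \near F, L2_sum mu (fun j x => m i j * a j x) (h i) /\
     forall j, `|m i j| <= 1) ->
  (forall j, m i j @[i --> F] --> 0) ->
  L2_inner mu (h i) (h i) @[i --> F] --> 0.
Proof.
move=> Sh m0; apply/cvgrPdist_le => e e0.
have e2 : 0 < e / 2 by rewrite divr_gt0.
have /cvgrPdist_le /(_ _ e2)[N _ HN] := L2_sum_normsq La orth Sf.
have s0 : \sum_(j < N) m i j ^+ 2 * L2_inner mu (a j) (a j) @[i --> F] --> 0.
  rewrite [X in _ --> X](_ : 0 = \sum_(j < N) 0 ^+ 2 * L2_inner mu (a j) (a j)).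
    apply: (cvg_big (op := +%R)) => [|j _]; first exact: add_continuous.
    apply: cvgMr_tmp; rewrite expr2.
    by under eq_fun do rewrite expr2; exact: cvgM.
  by rewrite big1// => j _; rewrite expr0n mul0r.
have /cvgrPdist_le /(_ _ e2) near_s := s0.
have := HN N (leqnn N) => /= tail.
apply: filterS2 Sh near_s => i [Si mi].
rewrite !sub0r !normrN ger0_norm; last first.
  by apply: sumr_ge0 => j _; rewrite mulr_ge0 ?sqr_ge0 ?normsq_ge0.
rewrite ger0_norm ?normsq_ge0// => near_si.
have := @multiplier_normsq (m i) N _ Si (fun j _ => mi j).
by move: tail; rewrite ler_norml => /andP[_]; lra.
Qed.

End multiplier.

End orthogonal_series.

(** * The subordinate generator in the eigenbasis *)

Lemma nneseries_lty (R : realType) (u : nat -> R) : (forall j, 0 <= u j) ->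
  cvgn (series u) -> (\sum_(j <oo) (u j)%:E < +oo)%E.
Proof.
move=> u0 /cvg_ex[l ul].
have /cvg_lim -> // : (\sum_(0 <= j < n) (u j)%:E)%E @[n --> \oo] --> l%:E.
  by under eq_fun do rewrite sumEFin; apply: cvg_EFin; [exact: nearW|exact: ul].
exact: ltry.
Qed.

Section subordinate_generator.
Context {R : realType} {M : ptopologicalType}.
Variable mu : {measure set (borel M) -> \bar R}.
Variables (lambda : nat -> R) (phi : nat -> M -> R).
Hypothesis Lphi : forall j, L2 mu (phi j).
Hypothesis phi_orthonormal : forall j k, L2_inner mu (phi j) (phi k) = (j == k)%:R.
Hypothesis phi_complete : forall f, L2 mu f ->
  L2_sum mu (fun j m => L2_inner mu f (phi j) * phi j m) f.
Hypothesis lambda_ge0 : forall j, 0 <= lambda j.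
Implicit Types (f g h q : M -> R) (s t : R).

Lemma expR_decay_le1 s x : 0 <= s -> 0 <= x -> `|expR (- s * x)| <= 1.
Proof.
by move=> s0 x0; rewrite ger0_norm ?expR_ge0// -expR0 ler_expR mulNr oppr_le0 mulr_ge0.
Qed.

Let coef_L2 f j : L2 mu (fun m => L2_inner mu f (phi j) * phi j m).
Proof. exact: L2Z. Qed.

Let coef_orth f j k : j != k ->
  L2_inner mu (fun m => L2_inner mu f (phi j) * phi j m)
              (fun m => L2_inner mu f (phi k) * phi k m) = 0.
Proof.
move=> jk; rewrite (innerZl _ (Lphi j) (coef_L2 f k)).
by rewrite [X in _ * X]innerC innerZl// phi_orthonormal eq_sym (negbTE jk) !mulr0.
Qed.

(** The heat operator is a representative chosen among the L^2 sums of a series;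
the choice is meaningful because the series converges, its multipliers being
at most 1 for nonnegative times and eigenvalues. *)
Lemma heat_sum s f : 0 <= s -> L2 mu f ->
  L2_sum mu (fun j m => expR (- s * lambda j) * (L2_inner mu f (phi j) * phi j m))
    (heat mu lambda phi s f).
Proof.
move=> s0 Lf; have := @multiplier_exists _ _ _ mu _ f (coef_L2 f) (@coef_orth f)
  (phi_complete Lf) (fun j => expR (- s * lambda j)) 1.
move=> /(_ (fun j => expR_decay_le1 s0 (lambda_ge0 j))) ex.
rewrite /heat; set S := [set h | _].
have -> : S = [set h | L2_sum mu
    (fun j m => expR (- s * lambda j) * (L2_inner mu f (phi j) * phi j m)) h].
  apply/seteqP; split=> h; rewrite /S /=; congr L2_sum;
  by apply/funext => j; apply/funext => m; rewrite mulrA.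
by case: ex => h Sh; exact: (xgetPex (fun=> 0) (ex_intro _ h Sh)).
Qed.

Lemma heatB_sum s f : 0 <= s -> L2 mu f ->
  L2_sum mu (fun j m => (expR (- s * lambda j) - 1) * (L2_inner mu f (phi j) * phi j m))
    (fun m => heat mu lambda phi s f m - f m).
Proof.
move=> s0 Lf.
have Le j : L2 mu (fun m => expR (- s * lambda j) * (L2_inner mu f (phi j) * phi j m)).
  exact: L2Z.
have := L2_sumB Le (coef_L2 f) (heat_sum s0 Lf) (phi_complete Lf).
congr L2_sum; apply/funext => j; apply/funext => m.
by rewrite mulrBl mul1r.
Qed.

Lemma inner_heatB s f q : 0 <= s -> L2 mu f -> L2 mu q ->
  \sum_(j < N) ((expR (- s * lambda j) - 1) *
     (L2_inner mu f (phi j) * L2_inner mu q (phi j))) @[N --> \oo] -->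
  L2_inner mu (fun m => heat mu lambda phi s f m - f m) q.
Proof.
move=> s0 Lf Lq; have := L2_sum_inner _ (heatB_sum s0 Lf) Lq.
move=> /(_ (fun j => L2Z _ (coef_L2 f j))).
under eq_fun do under eq_bigr do
  rewrite (innerZl _ (coef_L2 _ _) Lq) (innerZl _ (Lphi _) Lq) (innerC mu (phi _) q).
exact.
Qed.

Lemma coef_heatB s f k : 0 <= s -> L2 mu f ->
  L2_inner mu (fun m => heat mu lambda phi s f m - f m) (phi k) =
  (expR (- s * lambda k) - 1) * L2_inner mu f (phi k).
Proof.
move=> s0 Lf; rewrite (@L2_sum_coef _ _ _ _ _ _ _ k _ _ _ (heatB_sum s0 Lf))//.
- by rewrite !innerZl// phi_orthonormal eqxx mulr1.
- by move=> j; exact/L2Z/L2Z.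
- by move=> j jk; rewrite !innerZl// ?phi_orthonormal ?(negbTE jk) ?mulr0//; exact: L2Z.
Qed.

Variable nu : {measure set (measurableTypeR R) -> \bar R}.
Hypothesis nu_levy : is_levy_measure nu.
Let Psi := laplace_exponent nu.
Local Notation D := (`]0%R, +oo[%classic : set (measurableTypeR R)).

Let mD : measurable D.
Proof. exact: measurable_itv. Qed.

Lemma measurable_decay x : measurable_fun D (fun s : measurableTypeR R => (expR (- s * x) : R)).
Proof.
apply: (measurableT_comp (@measurable_expR R)).
by apply: measurable_funM => //; exact: measurable_oppr.
Qed.

(** The integrand is at most (x + 1) min(s, 1), by 1 - e^-y <= min(y, 1). *)
Lemma decay_integrable x : 0 <= x ->
  nu.-integrable D (fun s => (1 - expR (- s * x))%:E).
Proof.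
move=> x0.
apply: (@le_integrable _ _ _ _ _ mD _ (fun s => ((x + 1)%:E * (Num.min s 1)%:E)%E)).
- apply/measurable_EFinP; apply: measurable_funB => //; exact: measurable_decay.
- move=> s /=; rewrite in_itv/= andbT => s0.
  have h1 : expR (- s * x) <= 1.
    by have := expR_decay_le1 (ltW s0) x0; rewrite ger0_norm ?expR_ge0.
  have h2 : 1 - s * x <= expR (- s * x) by have := expR_ge1Dx (- s * x); lra.
  have h3 : 0 <= expR (- s * x) := expR_ge0 _.
  have m0 : 0 <= Num.min s 1 by rewrite le_min ler01 ltW.
  rewrite lee_fin !ger0_norm ?subr_ge0// ?mulr_ge0 ?addr_ge0//.
  case: (leP s 1) => _; nra.
- apply: integrableZl => //; apply/integrableP; split.
    by apply/measurable_EFinP; exact: measurable_minr.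
  rewrite (eq_integral (fun s : measurableTypeR R => (Num.min s 1)%:E)) => [|s].
    exact: nu_levy.
  rewrite inE /= in_itv/= andbT => s0.
  by rewrite ger0_norm// le_min ler01 ltW.
Qed.

Lemma laplace_exponent_ge0 x : 0 <= x -> 0 <= Psi x.
Proof.
move=> x0; apply: Rintegral_ge0 => s /=; rewrite in_itv/= andbT => s0.
by have := expR_decay_le1 (ltW s0) x0; rewrite ger0_norm ?expR_ge0// subr_ge0.
Qed.

Lemma EFin_laplace_exponent x : 0 <= x ->
  (\int[nu]_(s in D) (1 - expR (- s * x))%:E = (Psi x)%:E)%E.
Proof.
move=> x0; rewrite /Psi /laplace_exponent /Rintegral fineK//.
by apply: integrable_fin_num => //; exact: decay_integrable.
Qed.

(** Testing the weak integral against an eigenfunction turns P_s f - f into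
(e^(- s lambda_k) - 1) f_k, whose integral is - Psi(lambda_k) f_k. *)
Lemma subordinate_gen_coef f h k : subordinate_gen mu lambda phi nu f h ->
  L2_inner mu h (phi k) = - Psi (lambda k) * L2_inner mu f (phi k).
Proof.
move=> [Lf Lh /(_ (phi k) (Lphi k))[_ ->]].
transitivity (\int[nu]_(s in D)
    (- L2_inner mu f (phi k) * (1 - expR (- s * lambda k)))).
  apply: eq_Rintegral => s; rewrite inE /= in_itv/= andbT => s0.
  by rewrite (coef_heatB _ (ltW s0))//; ring.
rewrite RintegralZl//; last exact: decay_integrable.
by rewrite mulrC mulrN mulNr.
Qed.

Lemma coef_square_summable f : L2 mu f ->
  cvgn (series (fun j => L2_inner mu f (phi j) ^+ 2)).
Proof.
move=> Lf; apply/cvg_ex; exists (L2_inner mu f f).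
have := L2_sum_normsq (coef_L2 f) (@coef_orth f) (phi_complete Lf).
under eq_fun do under eq_bigr do rewrite normsqZ// phi_orthonormal eqxx mulr1.
under eq_fun do rewrite -(big_mkord xpredT (fun j => L2_inner mu f (phi j) ^+ 2)).
exact.
Qed.

Lemma coef_prod_summable f g : L2 mu f -> L2 mu g ->
  (\sum_(j <oo) (`|L2_inner mu f (phi j) * L2_inner mu g (phi j)|)%:E < +oo)%E.
Proof.
move=> Lf Lg; apply: nneseries_lty => //.
apply: (@series_le_cvg _ _ ((fun j => L2_inner mu f (phi j) ^+ 2) +
  (fun j => L2_inner mu g (phi j) ^+ 2))) => [j|j|j|] //=.
- by apply: addr_ge0; exact: sqr_ge0.
- set x := L2_inner mu f _; set y := L2_inner mu g _.
  rewrite -[leRHS]/(x ^+ 2 + y ^+ 2) ler_norml; apply/andP; split; nra.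
- by rewrite seriesD; apply: is_cvgD; exact: coef_square_summable.
Qed.

Lemma parseval f g : L2 mu f -> L2 mu g ->
  \sum_(j < N) (L2_inner mu f (phi j) * L2_inner mu g (phi j)) @[N --> \oo] -->
  L2_inner mu f g.
Proof.
move=> Lf Lg; have := L2_sum_inner (coef_L2 f) (phi_complete Lf) Lg.
under eq_fun do under eq_bigr do rewrite (innerZl _ (Lphi _) Lg) (innerC mu (phi _) g).
exact.
Qed.

(** The converse of [subordinate_gen_coef]. Here the test function q is arbitrary,
so that an integral and a series must be exchanged. The series of the
|e^(- s lambda_j) - 1| |f_j q_j| dominates its partial sums, and has the integral
sum_j Psi(lambda_j) |f_j q_j| = sum_j |h_j q_j|, finite because f_j Psi(lambda_j)
are up to sign the coefficients of an L^2 function. *)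
Lemma subordinate_gen_of_coef f h : L2 mu f -> L2 mu h ->
  (forall k, L2_inner mu h (phi k) = - Psi (lambda k) * L2_inner mu f (phi k)) ->
  subordinate_gen mu lambda phi nu f h.
Proof.
move=> Lf Lh hf; split => // q Lq.
pose x j := L2_inner mu f (phi j) * L2_inner mu q (phi j).
pose A j (s : measurableTypeR R) : R := (expR (- s * lambda j) - 1) * x j.
pose g (s : measurableTypeR R) := L2_inner mu (fun m => heat mu lambda phi s f m - f m) q.
have mA j : measurable_fun D (A j).
  by apply: measurable_funM => //; apply: measurable_funB => //; exact: measurable_decay.
have Ag s : D s -> \sum_(j < N) A j s @[N --> \oo] --> g s.
  by rewrite /= in_itv/= andbT => s0; exact: (inner_heatB (ltW s0)).
have absA j s : D s -> `|A j s| = `|x j| * (1 - expR (- s * lambda j)).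
  rewrite /= in_itv/= andbT => s0.
  have := expR_decay_le1 (ltW s0) (lambda_ge0 j); rewrite ger0_norm ?expR_ge0// => h1.
  by rewrite /A normrM mulrC distrC [X in _ * X]ger0_norm ?subr_ge0.
have iA j : nu.-integrable D (fun s => (A j s)%:E).
  have := integrableZl mD (- x j) (decay_integrable (lambda_ge0 j)).
  by congr (_.-integrable _ _); apply/funext => s; rewrite -EFinM /A; congr EFin; ring.
have intA j : \int[nu]_(s in D) A j s = - Psi (lambda j) * x j.
  transitivity (\int[nu]_(s in D) (- x j * (1 - expR (- s * lambda j)))).
    by apply: eq_Rintegral => s _; rewrite /A; ring.
  rewrite RintegralZl//; last exact: decay_integrable.
  by rewrite mulrC mulrN mulNr.
pose G (s : measurableTypeR R) := (\sum_(j <oo) `|A j s|%:E)%E.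
have G0 s : (0 <= G s)%E by apply: nneseries_ge0 => j _ _; rewrite lee_fin.
have mabsA j : measurable_fun D (fun s => `|A j s|%:E).
  by apply/measurable_EFinP; exact: measurableT_comp.
have iG : nu.-integrable D G.
  apply/integrableP; split.
    by apply: ge0_emeasurable_sum => // j s _ _; rewrite lee_fin.
  under eq_integral do rewrite gee0_abs ?G0//.
  rewrite integral_nneseries//.
  have Lhq := coef_prod_summable Lh Lq.
  rewrite (@eq_eseriesr _ _ (fun j => `|L2_inner mu h (phi j) * L2_inner mu q (phi j)|%:E)) => [//|j _].
  transitivity (\int[nu]_(s in D) (`|x j|%:E * (1 - expR (- s * lambda j))%:E))%E.
    by apply: eq_integral => s /set_mem Ds; rewrite absA.
  rewrite integralZl//; last exact: decay_integrable.
  rewrite EFin_laplace_exponent// -EFinM hf -mulrA -/(x j) [in RHS]normrM.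
  by rewrite normrN (ger0_norm (laplace_exponent_ge0 (lambda_ge0 j))) mulrC.
have mg : measurable_fun D g.
  apply: (@measurable_fun_cvg _ _ _ _ (fun N s => \sum_(j < N) A j s)).
    by move=> N; apply: measurable_sum => // j; exact: mA.
  exact: Ag.
have [] := @dominated_convergence _ _ _ nu D mD
  (fun N s => (\sum_(j < N) A j s)%:E) (fun s => (g s)%:E) G.
- by move=> N; apply/measurable_EFinP; apply: measurable_sum => // j; exact: mA.
- exact/measurable_EFinP.
- apply: nearW => s Ds; apply: cvg_EFin; first exact: nearW.
  exact: Ag.
- exact: iG.
- apply: nearW => s N Ds; rewrite /= (le_trans _ (nneseries_lim_ge N _))//.
  by rewrite sumEFin lee_fin big_mkord ler_norm_sum.
move=> ig _ cg; split => //.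
have cg' : \sum_(j < N) (L2_inner mu h (phi j) * L2_inner mu q (phi j))
    @[N --> \oo] --> \int[nu]_(s in D) g s.
  have /fine_cvg : (\int[nu]_(s in D) (\sum_(j < N) A j s)%R%:E)%E @[N --> \oo] -->
    (\int[nu]_(s in D) g s)%:E.
    by rewrite [X in _ --> X]fineK//; apply: integrable_fin_num.
  have -> // : fine \o (fun N => \int[nu]_(s in D) (\sum_(j < N) A j s)%R%:E)%E =
     (fun N => \sum_(j < N) L2_inner mu h (phi j) * L2_inner mu q (phi j)).
  apply/funext => N /=; under eq_integral do rewrite -sumEFin.
  rewrite integral_sum// -[RHS]/(fine (_%:E)) -sumEFin; congr fine.
  apply: eq_bigr => j _; rewrite hf -mulrA -/(x j) -intA fineK//.
  exact: integrable_fin_num.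
exact: (cvg_unique _ (parseval Lh Lq) cg').
Qed.

End subordinate_generator.

(** * Random fields in the product space *)

Section product_space.
Context {R : realType} {d1 d2 : measure_display}.
Context {Om : measurableType d1} {Y : measurableType d2}.
Variables (P : probability Om R) (mu : {finite_measure set Y -> \bar R}).
Local Notation PM := (P \x mu)%E.
Implicit Types (V W : Om * Y -> R) (q : Om -> R) (e : Y -> R).

Lemma measurable_section V w : measurable_fun setT V ->
  measurable_fun setT (fun y => V (w, y)).
Proof. by move=> mV; apply: measurableT_comp => //; exact: pair1_measurable. Qed.

Lemma section_L2 V : L2 PM V -> {ae P, forall w, L2 mu (fun y => V (w, y))}.
Proof.
move=> /L2P[mV iV]; have := ae_integrable1 iV; apply: filterS => w iw.
by apply/L2P; split => //; exact: measurable_section.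
Qed.

Definition tensor q e (z : Om * Y) : R := q z.1 * e z.2.

(** The random coefficients c_j of a field are of this form. *)
Definition section_coef V e (w : Om) : R := L2_inner mu (fun y => V (w, y)) e.

Lemma measurable_tensor q e : measurable_fun setT q -> measurable_fun setT e ->
  measurable_fun setT (tensor q e).
Proof.
by move=> mq me; apply: measurable_funM; apply: measurableT_comp.
Qed.

Lemma tensor_L2 q e : L2 P q -> L2 mu e -> L2 PM (tensor q e).
Proof.
move=> Lq Le; have mt := measurable_tensor (L2_measurable Lq) (L2_measurable Le).
apply/L2P; split => //; apply/integrable12ltyP.
  by apply/measurable_EFinP; exact: measurable_funM.
under eq_integral => w _.
  rewrite (eq_integral (fun y => (q w * q w)%:E * (e y * e y)%:E)%E); last first.
    move=> y _; rewrite gee0_abs -?EFinM ?lee_fin /tensor /= -?expr2 ?sqr_ge0//.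
    by rewrite exprMn.
  rewrite integralZl ?L2_mul_integrable// -EFin_inner// muleC.
  over.
rewrite /= integralZl ?L2_mul_integrable// -EFin_inner// -EFinM.
exact: ltry.
Qed.

Lemma L2_one : L2 P (fun=> 1).
Proof. exact: Lfun_cst. Qed.

Lemma measurable_section_coef V e : L2 PM V -> L2 mu e ->
  measurable_fun setT (section_coef V e).
Proof.
move=> LV Le; have Lt := tensor_L2 L2_one Le.
have iF := L2_mul_integrable LV Lt.
have -> : section_coef V e = fine \o fubini_F mu (fun z => (V z * tensor (fun=> 1) e z)%:E).
  apply/funext => w; rewrite /section_coef /L2_inner /Rintegral /fubini_F /=.
  by congr fine; apply: eq_integral => y _; rewrite /tensor mul1r.
exact: (measurableT_comp (fine_measurable measurableT) (measurable_fubini_F iF)).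
Qed.

Lemma section_coef_L2 V e : L2 PM V -> L2 mu e -> L2 P (section_coef V e).
Proof.
move=> LV Le; have mc := measurable_section_coef LV Le.
apply/L2P; split => //.
have iVV := L2_mul_integrable LV LV.
have iF := integrable_fubini_F iVV.
have iFe := integrableZl measurableT (L2_inner mu e e) iF.
have mcc : measurable_fun setT (EFin \o (fun w => section_coef V e w * section_coef V e w)).
  by apply/measurable_EFinP; exact: measurable_funM.
apply/integrableP; split => //.
have /integrableP[mFe] := iFe; apply: le_lt_trans.
apply: ae_ge0_le_integral => //.
- exact: (measurableT_comp (@abse_measurable R setT) mcc).
- exact: (measurableT_comp (@abse_measurable R setT) mFe).
have := section_L2 LV; apply: filterS => w LVw _.
rewrite /fubini_F -EFin_inner// -EFinM lee_fin -expr2 normrX real_normK ?num_real//.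
apply: le_trans (ler_norm _).
by rewrite mulrC; exact: cauchy_schwarz.
Qed.

(** Fubini. Pairing with the q (x) phi_k thus reads the coefficient processes of
V in the weak sense of L^2(dP), which is linear in V and continuous. *)
Lemma inner_tensor V q e : L2 PM V -> L2 P q -> L2 mu e ->
  L2_inner PM V (tensor q e) = L2_inner P (section_coef V e) q.
Proof.
move=> LV Lq Le; have Lt := tensor_L2 Lq Le.
have iVt := L2_mul_integrable LV Lt; congr fine.
rewrite -integral12_prod_meas1//; apply: ae_eq_integral => //.
- exact: (measurable_fubini_F iVt).
- apply/measurable_EFinP; apply: measurable_funM; last exact: L2_measurable Lq.
  exact: measurable_section_coef.
have := section_L2 LV; apply: filterS => w LVw _.
rewrite /fubini_F.
transitivity (\int[mu]_y ((q w)%:E * (V (w, y) * e y)%:E))%E.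
  by apply: eq_integral => y _; rewrite -EFinM /tensor /=; congr EFin; ring.
by rewrite integralZl ?L2_mul_integrable// -EFin_inner// -EFinM mulrC.
Qed.

Lemma inner_tensor2 q q' e e' : L2 P q -> L2 P q' -> L2 mu e -> L2 mu e' ->
  L2_inner PM (tensor q e) (tensor q' e') = L2_inner P q q' * L2_inner mu e e'.
Proof.
move=> Lq Lq' Le Le'; rewrite inner_tensor//; last exact: tensor_L2.
rewrite mulrC -innerZl//; congr L2_inner; apply/funext => w.
by rewrite /section_coef /tensor /= innerZl// mulrC.
Qed.

Variable phi : nat -> Y -> R.
Hypothesis Lphi : forall j, L2 mu (phi j).
Hypothesis phi_orthonormal : forall j k, L2_inner mu (phi j) (phi k) = (j == k)%:R.
Hypothesis phi_complete : forall f, L2 mu f ->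
  L2_sum mu (fun j m => L2_inner mu f (phi j) * phi j m) f.

(** The test variable q may be the coefficient itself. *)
Lemma tensor_coef_ae0 V k : L2 PM V ->
  (forall q, L2 P q -> L2_inner PM V (tensor q (phi k)) = 0) ->
  {ae P, forall w, section_coef V (phi k) w = 0}.
Proof.
move=> LV V0; have Lc := section_coef_L2 LV (Lphi k).
by apply: normsq0_ae => //; rewrite -inner_tensor// V0.
Qed.

Lemma tensor_coef_ae V W c k : L2 PM V -> L2 PM W ->
  (forall q, L2 P q ->
     L2_inner PM V (tensor q (phi k)) = c * L2_inner PM W (tensor q (phi k))) ->
  {ae P, forall w, section_coef V (phi k) w = c * section_coef W (phi k) w}.
Proof.
move=> LV LW VW; have LcW := L2Z c LW; have LD := L2B LV LcW.
have D0 : {ae P, forall w, section_coef (fun z => V z - c * W z) (phi k) w = 0}.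
  apply: tensor_coef_ae0 => // q Lq.
  have Lt := tensor_L2 Lq (Lphi k).
  by rewrite innerBl// VW// innerZl// subrr.
apply: filterS3 D0 (section_L2 LV) (section_L2 LW) => w + LVw LWw.
have LcWw := L2Z c LWw.
by rewrite /section_coef innerBl// innerZl// => /eqP; rewrite subr_eq0 => /eqP.
Qed.

(** For almost every w all coefficients of the path of V at w vanish, hence so
does the path, by completeness of the basis. Equalities in L^2(dP (x) dmu) are
thereby reduced to equalities of the scalars <V, q (x) phi_k>. *)
Lemma tensor_total V : L2 PM V ->
  (forall k q, L2 P q -> L2_inner PM V (tensor q (phi k)) = 0) ->
  {ae PM, forall z, V z = 0}.
Proof.
move=> LV V0.
have c0 : {ae P, forall w, forall k, section_coef V (phi k) w = 0}.
  by apply: ae_foralln => k; apply: tensor_coef_ae0 => // q; exact: V0.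
apply: normsq0_ae => //; rewrite /L2_inner /Rintegral.
have iVV := L2_mul_integrable LV LV.
rewrite -integral12_prod_meas1// (ae_eq_integral (cst 0%E))//.
- by rewrite integral0.
- exact: (measurable_fubini_F iVV).
apply: filterS2 c0 (section_L2 LV) => w c0w LVw _.
rewrite /fubini_F -EFin_inner//; congr EFin.
have S := phi_complete LVw.
have La j : L2 mu (fun m => L2_inner mu (fun y => V (w, y)) (phi j) * phi j m).
  exact: L2Z.
have Z j : L2_inner mu (fun m => L2_inner mu (fun y => V (w, y)) (phi j) * phi j m)
    (fun y => V (w, y)) = 0.
  by rewrite innerZl// -/(section_coef V (phi j) w) c0w mul0r.
have := L2_sum_inner La S LVw.
under eq_fun do rewrite (eq_bigr (fun=> 0) (fun (j : 'I__) _ => Z j)) big1_eq.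
by move=> h; exact: (cvg_unique _ h (cvg_cst _)).
Qed.

Lemma tensor_phi_orth (c : nat -> Om -> R) : (forall j, L2 P (c j)) ->
  forall j k, j != k ->
  L2_inner PM (tensor (c j) (phi j)) (tensor (c k) (phi k)) = 0.
Proof. by move=> Lc j k jk; rewrite inner_tensor2// phi_orthonormal (negbTE jk) mulr0. Qed.

Lemma inner_tensor_sum (c : nat -> Om -> R) (x : nat -> R) V k q :
  (forall j, L2 P (c j)) -> L2 P q ->
  L2_sum PM (fun j z => x j * tensor (c j) (phi j) z) V ->
  L2_inner PM V (tensor q (phi k)) = x k * L2_inner P (c k) q.
Proof.
move=> Lc Lq SV; have Lt j : L2 PM (tensor (c j) (phi j)) by exact: tensor_L2.
have Ltq j : L2 PM (tensor q (phi j)) by exact: tensor_L2.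
rewrite (L2_sum_coef (k := k) _ _ _ SV)//.
- by rewrite innerZl// inner_tensor2// phi_orthonormal eqxx mulr1.
- by move=> j; exact: L2Z.
- by move=> j jk; rewrite innerZl// inner_tensor2// phi_orthonormal (negbTE jk) !mulr0.
Qed.

(** The expansion of a random field. By Bessel's inequality the series converges
to some W, and W = V because both have the same pairings with the
q (x) phi_k. *)
Lemma tensor_expansion V : L2 PM V ->
  L2_sum PM (fun j => tensor (section_coef V (phi j)) (phi j)) V.
Proof.
move=> LV; pose c j := section_coef V (phi j).
have Lc j : L2 P (c j) by exact: section_coef_L2.
have Lt j : L2 PM (tensor (c j) (phi j)) by exact: tensor_L2.
have orth := tensor_phi_orth Lc.
have VtE j : L2_inner PM V (tensor (c j) (phi j)) = L2_inner P (c j) (c j).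
  by rewrite inner_tensor.
have tt j : L2_inner PM (tensor (c j) (phi j)) (tensor (c j) (phi j)) =
    L2_inner P (c j) (c j).
  by rewrite inner_tensor2// phi_orthonormal eqxx mulr1.
have [|W SW] := L2_sum_exists Lt orth.
  apply: nondecreasing_is_cvgn.
    by apply: nondecreasing_series => j _ _; exact: normsq_ge0.
  exists (L2_inner PM V V) => _ [N _ <-] /=.
  have LS := L2_sumr (index_iota 0 N) xpredT Lt.
  have := normsq_ge0 PM (fun z => V z - \sum_(j <- index_iota 0 N) tensor (c j) (phi j) z).
  rewrite normsqB// (normsq_sum Lt orth (iota_uniq _ _)).
  rewrite innerC (inner_suml _ _ Lt LV).
  under eq_bigr do rewrite innerC VtE -tt.
  by rewrite /series/=; lra.
have LW := SW.1; have LWV := L2B LW LV.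
apply: (L2_sum_ae Lt (L2_measurable LV) _ SW).
suff : {ae PM, forall z, W z - V z = 0}.
  by apply: filterS => z /eqP; rewrite subr_eq0 => /eqP.
apply: tensor_total => // k q Lq.
have Ltq := tensor_L2 Lq (Lphi k).
rewrite innerBl// (inner_tensor LV Lq (Lphi k)).
rewrite (@inner_tensor_sum c (fun=> 1) W k q Lc Lq) ?mul1r ?subrr//.
have := SW; congr L2_sum.
by apply/funext => j; apply/funext => z; rewrite mul1r.
Qed.

End product_space.

(** * Scalar estimates and the scalar equation *)

Section calculus.
Context {R : realType}.
Implicit Types x y t h psi : R.

(** Both bounds come from e^x >= 1 + x, the upper one through the same inequality
at - x, in the form e^x - 1 <= x e^x. *)
Lemma expR_remainder_le x : 0 <= expR x - 1 - x <= x ^+ 2 * expR `|x|.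
Proof.
have h1 := expR_ge1Dx x; have h2 := expR_ge1Dx (- x).
have e0 := expR_gt0 x; have eN : expR x * expR (- x) = 1 by rewrite -expRD subrr expR0.
have h3 : expR x - 1 <= x * expR x by nra.
apply/andP; split; first by lra.
have [x0|x0] := lerP 0 x.
  by rewrite ger0_norm//; nra.
have h4 : 1 <= expR `|x| by rewrite -expR0 ler_expR.
have h5 : 0 <= x ^+ 2 by exact: sqr_ge0.
have h6 : x * (expR x - 1) <= x * x by nra.
by rewrite expr2 in h5 *; nra.
Qed.

(** The constant does not depend on y: half of the decay e^(- t y) absorbs the
growth e^(|h| y) of the Taylor remainder, the other half absorbs y^2. This
uniformity in the spectral parameter makes t |-> e^(- t Psi) differentiable in
operator norm at t > 0, although the generator is unbounded. *)
Lemma semigroup_quotient_remainder y t h : 0 <= y -> 0 < t -> h != 0 -> `|h| <= t / 2 ->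
  `|h^-1 * (expR (- (t + h) * y) - expR (- t * y)) + y * expR (- t * y)|
    <= 16 / t ^+ 2 * `|h|.
Proof.
move=> y0 t0 h0 ht; set x := - h * y.
have -> : h^-1 * (expR (- (t + h) * y) - expR (- t * y)) + y * expR (- t * y) =
    h^-1 * (expR (- t * y) * (expR x - 1 - x)).
  have -> : - (t + h) * y = - t * y + x by rewrite /x; ring.
  by rewrite expRD /x; field.
have /andP[r0 r1] := expR_remainder_le x.
have nx : `|x| = `|h| * y by rewrite normrM normrN (ger0_norm y0).
have hp : 0 < `|h| by rewrite normr_gt0.
rewrite normrM normfV ler_pdivrMl// ger0_norm ?mulr_ge0 ?expR_ge0//.
have le1 : expR (- t * y) * (expR x - 1 - x) <= x ^+ 2 * expR (- (t / 2) * y).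
  apply: (@le_trans _ _ (expR (- t * y) * (x ^+ 2 * expR `|x|))).
    by rewrite ler_wpM2l ?expR_ge0.
  rewrite mulrCA -expRD ler_wpM2l ?sqr_ge0// ler_expR nx.
  have : `|h| * y <= t / 2 * y by rewrite ler_wpM2r.
  by lra.
apply: le_trans le1 _.
(* 16 / t ^ 2 is the square of 4 / t, from e^(t y / 4) >= t y / 4. *)
have e4 := expR_ge1Dx (t / 4 * y).
have E : expR (t / 4 * y) * expR (t / 4 * y) * expR (- (t / 2) * y) = 1.
  by rewrite -!expRD -[RHS]expR0; congr expR; field.
have ty : 0 <= t / 4 * y by rewrite mulr_ge0// divr_ge0// ltW.
have e5 : (t / 4 * y) ^+ 2 * expR (- (t / 2) * y) <= 1.
  rewrite -[leRHS]E expr2 ler_wpM2r ?expR_ge0//.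
  by apply: ler_pM => //; lra.
have -> : x ^+ 2 * expR (- (t / 2) * y) =
  (16 / t ^+ 2 * `|h| ^+ 2) * ((t / 4 * y) ^+ 2 * expR (- (t / 2) * y)).
  rewrite real_normK ?num_real// /x; field.
  by rewrite lt0r_neq0.
have -> : `|h| * (16 / t ^+ 2 * `|h|) = 16 / t ^+ 2 * `|h| ^+ 2 by ring.
rewrite ler_piMr//.
by rewrite mulr_ge0 ?sqr_ge0// divr_ge0// sqr_ge0.
Qed.

Lemma semigroup_derivative_bound y t : 0 <= y -> 0 < t ->
  `|- y * expR (- t * y)| <= t^-1.
Proof.
move=> y0 t0; rewrite normrM normrN (ger0_norm y0) (ger0_norm (expR_ge0 _)).
rewrite -[leRHS]mul1r ler_pdivlMr//.
have E : expR (t * y) * expR (- t * y) = 1 by rewrite -expRD mulNr subrr expR0.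
have := expR_ge1Dx (t * y); have := expR_gt0 (- t * y); nra.
Qed.

Lemma decay_cvg psi : expR (- t * psi) @[t --> 0^'+] --> (1 : R).
Proof.
have /derivable1_diffP/differentiable_continuous h :
  derivable (fun t : R => expR (- t * psi)) 0 1 by [].
have := cvg_at_right_filter h; by rewrite oppr0 mul0r expR0.
Qed.

(** The function e^(t psi) f(t) has derivative 0 on the positive half-line, hence is
constant there, and the constant is its limit at 0+. *)
Lemma linear_ode_solution psi (f : R -> R) :
  (forall t, 0 < t -> h^-1 * (f (t + h) - f t) @[h --> 0^'] --> - psi * f t) ->
  f t @[t --> 0^'+] --> f 0 ->
  forall t, 0 < t -> f t = expR (- t * psi) * f 0.
Proof.
move=> df f0.
have Df t : 0 < t -> is_derive t 1 f (- psi * f t).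
  move=> t0; have h := df t t0.
  have h' : (fun h => h^-1 *: ((f \o shift t) (h *: (1 : R)) - f t)) @ 0^' --> - psi * f t.
    have -> // : (fun h => h^-1 *: ((f \o shift t) (h *: (1 : R)) - f t)) =
      (fun h => h^-1 * (f (t + h) - f t)).
    by apply/funext => k; rewrite /= -[k *: 1]/(k * 1) mulr1 (addrC k).
  split; first by apply/cvg_ex; exists (- psi * f t).
  exact: cvg_lim.
pose G t := expR (t * psi) * f t.
have De t : is_derive t 1 (fun s : R => expR (s * psi)) (psi * expR (t * psi)).
  by apply: is_derive_eq; rewrite /GRing.scale/=; ring.
have DG t : 0 < t -> is_derive t 1 G 0.
  move=> t0; have := Df t t0 => Dft; apply: is_derive_eq; rewrite /GRing.scale/=.
  by ring.
have cst s t : 0 < s -> s < t -> G s = G t.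
  move=> s0 st.
  have [||c _] := @MVT _ G (fun=> 0) s t st.
  - by move=> x; rewrite in_itv/= => /andP[sx _]; apply: DG; exact: lt_trans sx.
  - apply: derivable_within_continuous => x; rewrite in_itv/= => /andP[sx _].
    by have := DG x (lt_le_trans s0 sx) => ?; exact: ex_derive.
  - by rewrite mul0r => /eqP; rewrite subr_eq0 => /eqP.
move=> t t0.
have h1 : G s @[s --> 0^'+] --> 1 * f 0.
  apply: cvgM => //; have := @decay_cvg (- psi).
  by under eq_fun do rewrite mulrNN.
have h2 : G s @[s --> 0^'+] --> G t.
  apply: cvg_near_cst; near=> s; apply: cst; first by near: s; exact: nbhs_right_gt.
  by near: s; exact: nbhs_right_lt.
have : 1 * f 0 = G t by exact: (cvg_unique _ h1 h2).
by rewrite mul1r => ->; rewrite /G mulrA -expRD mulNr addNr expR0 mul1r.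
Unshelve. all: by end_near. Qed.

End calculus.

(** * The Cauchy problem for a measurable field *)

Section cauchy_problem.
Context {R : realType} {M : ptopologicalType}.
Variable mu : {finite_measure set (borel M) -> \bar R}.
Variables (lambda : nat -> R) (phi : nat -> M -> R).
Hypothesis Lphi : forall j, L2 mu (phi j).
Hypothesis phi_orthonormal : forall j k, L2_inner mu (phi j) (phi k) = (j == k)%:R.
Hypothesis phi_complete : forall f, L2 mu f ->
  L2_sum mu (fun j m => L2_inner mu f (phi j) * phi j m) f.
Hypothesis lambda_ge0 : forall j, 0 <= lambda j.
Variable nu : {measure set (measurableTypeR R) -> \bar R}.
Hypothesis nu_levy : is_levy_measure nu.
Context {d : measure_display} {Om : measurableType d}.
Variables (P : probability Om R) (T : M -> Om -> R) (X0 : Om * borel M -> R).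
Hypothesis LX0 : L2 (P \x mu)%E X0.
Hypothesis TX0 : {ae (P \x mu)%E, forall z, T z.2 z.1 = X0 z}.
Local Notation PM := (P \x mu)%E.
Local Notation tensor := (@tensor R _ _ Om (borel M)).
Implicit Types (s t : R) (u : R -> Om * borel M -> R).

Let psi j := laplace_exponent nu (lambda j).
Let c j := section_coef mu X0 (phi j).
Let A j : Om * borel M -> R := tensor (c j) (phi j).

Let psi_ge0 j : 0 <= psi j. Proof. exact: laplace_exponent_ge0. Qed.
Let Lc j : L2 P (c j). Proof. exact: section_coef_L2. Qed.
Let LA j : L2 PM (A j). Proof. exact: tensor_L2. Qed.
Let orthA j k : j != k -> L2_inner PM (A j) (A k) = 0.
Proof. by move=> jk; exact: (tensor_phi_orth Lphi phi_orthonormal Lc). Qed.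
Let SA : L2_sum PM A X0. Proof. exact: (tensor_expansion Lphi phi_orthonormal phi_complete). Qed.
Let LmA (m : nat -> R) j : L2 PM (fun z => m j * A j z). Proof. exact: L2Z. Qed.

(** X0 is a measurable version of the field, so that its coefficients are
measurable. *)
Definition is_series_solution u := forall t, 0 <= t ->
  L2_sum PM (fun j z => expR (- t * psi j) * A j z) (u t).

Let flow_le1 t j : 0 <= t -> `|expR (- t * psi j)| <= 1.
Proof. by move=> t0; exact: expR_decay_le1. Qed.

Lemma series_solution_exists : exists u, is_series_solution u.
Proof.
have /choice[u Hu] : forall t, exists v, 0 <= t ->
    L2_sum PM (fun j z => expR (- t * psi j) * A j z) v.
  move=> t; have [t0|t0] := lerP 0 t; last by exists (fun=> 0).
  have [v Sv] := multiplier_exists LA orthA SA (fun j => flow_le1 j t0).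
  by exists v.
by exists u.
Qed.

Lemma series_solution0 u : is_series_solution u ->
  {ae PM, forall z, u 0 z = X0 z}.
Proof.
move=> Su; have S0 := Su 0 (lexx 0); apply: (L2_sum_unique (LmA _) S0).
have := SA; congr L2_sum; apply/funext => j; apply/funext => z.
by rewrite oppr0 mul0r expR0 mul1r.
Qed.

Lemma series_solution_cvg0 u : is_series_solution u ->
  L2dist PM (u t) (u 0) @[t --> 0^'+] --> 0%E.
Proof.
move=> Su; have S0 := Su 0 (lexx 0).
have near_pos : \forall t \near (0 : R)^'+, (0 : R) < t by exact: nbhs_right_gt.
apply/(L2dist_cvgP (f := u)).
- by apply: filterS near_pos => t /ltW/Su[].
- by case: S0.
apply: (@multiplier_cvg0 _ _ _ PM A X0 LA orthA SA _ _ _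
  (fun t j => expR (- t * psi j) - 1) (fun t z => u t z - u 0 z)).
- apply: filterS near_pos => t t0; split.
    have := L2_sumB (LmA _) (LmA _) (Su t (ltW t0)) S0; congr L2_sum.
    by apply/funext => j; apply/funext => z; rewrite oppr0 mul0r expR0 mulrBl.
  move=> j; have := flow_le1 j (ltW t0); rewrite (ger0_norm (expR_ge0 _)) => h.
  rewrite distrC ger0_norm ?subr_ge0 // lerBlDr lerDl expR_ge0.
- move=> j; rewrite -[X in _ --> X](subrr (1 : R)).
  by apply: cvgB; [exact: decay_cvg|exact: cvg_cst].
Qed.

(** In the orthogonal expansion the error of the difference quotient is a multiplier
of size O(|h|), by [semigroup_quotient_remainder]. *)
Lemma series_solution_derivative u t du : is_series_solution u -> 0 < t ->
  L2_sum PM (fun j z => (- psi j * expR (- t * psi j)) * A j z) du ->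
  L2dist PM (fun z => h^-1 * (u (t + h) z - u t z)) du @[h --> (0 : R)^'] --> 0%E.
Proof.
move=> Su t0 Sdu.
have t2 : 0 < t / 2 by rewrite divr_gt0.
have near_h : \forall h \near (0 : R)^', h != 0 /\ `|h| <= t / 2.
  have le_h : \forall h \near (0 : R)^', `|h| <= t / 2 by exact: (@dnbhs0_le R R _ t2).
  by apply: filterS2 (nbhs_dnbhs_neq (0 : R)) le_h => h.
have near_pos : \forall h \near (0 : R)^', 0 <= t + h.
  apply: filterS near_h => h [_]; rewrite ler_norml => /andP[+ _].
  by move: t0; lra.
pose q h z := h^-1 * (u (t + h) z - u t z).
have Sq h : 0 <= t + h -> L2_sum PM (fun j z =>
    (h^-1 * (expR (- (t + h) * psi j) - expR (- t * psi j))) * A j z) (q h).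
  move=> th0.
  have LB j : L2 PM (fun z => expR (- (t + h) * psi j) * A j z - expR (- t * psi j) * A j z).
    by apply: L2B; exact: L2Z.
  have := L2_sumZ h^-1 LB (L2_sumB (LmA _) (LmA _) (Su _ th0) (Su t (ltW t0))).
  by congr L2_sum; apply/funext => j; apply/funext => z; ring.
apply/(L2dist_cvgP (f := q)).
- by apply: filterS near_pos => h /Sq[].
- by case: Sdu.
have b0 : (16 / t ^+ 2 * `|h|) ^+ 2 * L2_inner PM X0 X0 @[h --> (0 : R)^'] --> 0.
  have n0 : 16 / t ^+ 2 * `|h| @[h --> (0 : R)^'] --> 0.
    rewrite -[X in _ --> X](mulr0 (16 / t ^+ 2)); apply: cvgMl_tmp.
    have /cvg_norm : h @[h --> (0 : R)^'] --> (0 : R) by exact: cvg_within.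
    by rewrite normr0.
  rewrite -[X in _ --> X](mul0r (L2_inner PM X0 X0)); apply: cvgMr_tmp.
  have -> : (fun h : R => (16 / t ^+ 2 * `|h|) ^+ 2) =
      (fun h => 16 / t ^+ 2 * `|h|) * (fun h => 16 / t ^+ 2 * `|h|).
    by apply/funext => h; rewrite expr2.
  by rewrite -[X in _ --> X](mulr0 (0 : R)); exact: cvgM.
apply: (squeeze_cvgr _ (cvg_cst 0) b0).
apply: filterS2 near_h near_pos => h [h0 ht] th0.
rewrite normsq_ge0 /=; apply: (multiplier_normsq_le (m := fun j =>
  h^-1 * (expR (- (t + h) * psi j) - expR (- t * psi j)) + psi j * expR (- t * psi j))
  LA orthA SA).
- by rewrite mulr_gt0 ?normr_gt0// divr_gt0 ?exprn_gt0.
- have := L2_sumB (LmA _) (LmA _) (Sq h th0) Sdu; congr L2_sum.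
  by apply/funext => j; apply/funext => z; ring.
- by move=> j; exact: semigroup_quotient_remainder.
Unshelve. all: by end_near. Qed.

Lemma series_solution_is_solution u : is_series_solution u ->
  is_solution P mu lambda phi nu T u.
Proof.
move=> Su; split.
- by move=> t /Su[].
- by apply: filterS2 (series_solution0 Su) TX0 => z -> ->.
- exact: series_solution_cvg0.
move=> t t0.
have [du Sdu] := multiplier_exists LA orthA SA
  (fun j => semigroup_derivative_bound (psi_ge0 j) t0).
exists du; split; [by case: Sdu|exact: series_solution_derivative|].
have St := Su t (ltW t0); have Lu := St.1; have Ldu := Sdu.1.
have coefs : {ae P, forall w, forall k, section_coef mu du (phi k) w =
    - psi k * section_coef mu (u t) (phi k) w}.
  apply: ae_foralln => k; apply: tensor_coef_ae => // q Lq.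
  rewrite (inner_tensor_sum Lphi phi_orthonormal k Lc Lq Sdu).
  by rewrite (inner_tensor_sum Lphi phi_orthonormal k Lc Lq St) mulrA.
apply: filterS3 coefs (section_L2 Lu) (section_L2 Ldu) => w cw Luw Lduw.
exact: subordinate_gen_of_coef.
Qed.

(** Uniqueness. For a solution u, each f(t) = <u_t, q (x) phi_k> satisfies
f' = - Psi(lambda_k) f for t > 0, with right limit f(0) at 0: the operator enters
only through its action on one eigenfunction. Hence f(t) = e^(- t Psi(lambda_k)) f(0)
is the pairing of the series with q (x) phi_k, and the q (x) phi_k are total. *)
Lemma solution_is_series_solution u : is_solution P mu lambda phi nu T u ->
  is_series_solution u.
Proof.
move=> [Lu u0 cvg0 du]; have [v Sv] := series_solution_exists.
have L0 := Lu 0 (lexx 0).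
have uX : {ae PM, forall z, u 0 z = X0 z}.
  by apply: filterS2 u0 TX0 => z -> ->.
have tested k q t : L2 P q -> 0 < t -> L2_inner PM (u t) (tensor q (phi k)) =
    expR (- t * psi k) * L2_inner P (c k) q.
  move=> Lq; have Ltq : L2 PM (tensor q (phi k)) by exact: tensor_L2.
  pose f t := L2_inner PM (u t) (tensor q (phi k)).
  have -> : L2_inner P (c k) q = f 0.
    rewrite /f (inner_ae _ _ _ uX) ?inner_tensor//.
    - exact: L2_measurable L0.
    - exact: L2_measurable LX0.
    - exact: L2_measurable Ltq.
  move: t; apply: linear_ode_solution; last first.
    have near_pos : \forall t \near (0 : R)^'+, L2 PM (u t).
      by near=> t; apply: Lu; near: t; exact: nbhs_right_ge.
    apply: (inner_cvg (f := u)) => //.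
    exact/(L2dist_cvgP (f := u) near_pos L0).
  move=> t t0; have [dut [Ldu cdu gen]] := du t t0.
  have -> : - psi k * f t = L2_inner PM dut (tensor q (phi k)).
    rewrite /f (inner_tensor (Lu t (ltW t0)) Lq (Lphi k)) (inner_tensor Ldu Lq (Lphi k)).
    rewrite -innerZl//; last exact/section_coef_L2/Lphi/Lu/ltW.
    have Lcu : L2 P (section_coef mu (u t) (phi k)) by apply: section_coef_L2 => //; exact/Lu/ltW.
    have Lcd : L2 P (section_coef mu dut (phi k)) by exact: section_coef_L2.
    apply: inner_ae.
    - exact: L2_measurable (L2Z _ Lcu).
    - exact: L2_measurable Lcd.
    - exact: L2_measurable Lq.
    apply: filterS gen => w gen_w; apply/esym.
    exact: (subordinate_gen_coef Lphi phi_orthonormal phi_complete lambda_ge0 nu_levy k gen_w).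
  have near_pos : \forall h \near (0 : R)^', 0 <= t + h.
    near=> h; have : `|h| < t by near: h; exact: (@dnbhs0_lt R R _ t0).
    by rewrite ltr_norml => /andP[]; lra.
  have near_L : \forall h \near (0 : R)^', L2 PM (fun z => h^-1 * (u (t + h) z - u t z)).
    apply: filterS near_pos => h th0; apply: L2Z; apply: L2B; apply: Lu => //.
    exact: ltW.
  pose Q h z := h^-1 * (u (t + h) z - u t z).
  have near_LQ : \forall h \near (0 : R)^', L2 PM (Q h) by exact: near_L.
  have h0 := (L2dist_cvgP (f := Q) near_LQ Ldu).1 cdu.
  have FF : Filter (0 : R)^' by exact: dnbhs_filter.
  have h1 := inner_cvg (f := Q) near_LQ Ldu Ltq (h0 FF).
  refine (cvg_trans _ (h1 FF)); apply: near_eq_cvg.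
  apply: filterS near_pos => h th0.
  have Lth := Lu _ th0; have Lt := Lu t (ltW t0).
  by rewrite innerZl ?innerBl//; exact: L2B.
move=> t; rewrite le_eqVlt => /predU1P[<-|t0].
  apply: (L2_sum_ae (LmA _) (L2_measurable L0) _ (Sv 0 (lexx 0))).
  by apply: filterS2 uX (series_solution0 Sv) => z -> ->.
have Svt := Sv t (ltW t0); have Lv := Svt.1; have Lut := Lu t (ltW t0).
apply: (L2_sum_ae (LmA _) (L2_measurable Lut) _ Svt).
suff : {ae PM, forall z, v t z - u t z = 0}.
  by apply: filterS => z /eqP; rewrite subr_eq0 => /eqP.
apply: (tensor_total Lphi phi_complete); first exact: L2B.
move=> k q Lq; have Ltq : L2 PM (tensor q (phi k)) by exact: tensor_L2.
rewrite innerBl// tested// (inner_tensor_sum Lphi phi_orthonormal k Lc Lq Svt).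
by rewrite subrr.
Unshelve. all: by end_near. Qed.

End cauchy_problem.

(** * Integrals of nonmeasurable functions *)

Section lower_integral.
Context {d : measure_display} {X : measurableType d} {R : realType}.
Variable mu : {measure set X -> \bar R}.
Local Open Scope ereal_scope.
Import HBNNSimple.

Lemma ge0_le_lower_integral (f g : X -> \bar R) :
  (forall x, 0 <= f x) -> (forall x, f x <= g x) ->
  \int[mu]_x f x <= \int[mu]_x g x.
Proof.
move=> f0 fg; have g0 x : 0 <= g x by exact: le_trans (fg x).
rewrite !ge0_integralTE//; apply: ereal_sup_le => _ [h /= hf <-].
by exists h => // x; exact: le_trans (fg x).
Qed.

(** No measurability is assumed: the integral of a nonnegative function is then a
lower integral, and a simple function below f can be cut off on N without
changing its integral. The coefficients c_j of a field whose exceptional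
paths are arbitrary need not be measurable, so this generality is used. *)
Lemma ge0_lower_integral_off_null (f g : X -> \bar R) (N : set X) :
  measurable N -> mu N = 0 -> (forall x, 0 <= f x) -> (forall x, 0 <= g x) ->
  (forall x, ~ N x -> f x = g x) ->
  \int[mu]_x f x = \int[mu]_x g x.
Proof.
move=> mN N0.
wlog suff : f g / (forall x, 0 <= f x) -> (forall x, 0 <= g x) ->
    (forall x, ~ N x -> f x = g x) -> \int[mu]_x f x <= \int[mu]_x g x.
  move=> H f0 g0 fg; apply/eqP; rewrite eq_le !H// => x Nx.
  by rewrite fg.
move=> f0 g0 fg; rewrite ge0_integralTE//; apply: ge_ereal_sup => _ [h /= hf <-].
pose h' : {nnsfun X >-> R} := proj_nnsfun h (measurableC mN).
have -> : sintegral mu h = sintegral mu h'.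
  rewrite -!integralT_nnsfun; apply: ge0_ae_eq_integral => //.
  - exact/measurable_EFinP.
  - exact/measurable_EFinP.
  - by move=> x _; rewrite lee_fin.
  - by move=> x _; rewrite lee_fin.
  exists N; split => // x /= hx; apply: contrapT => Nx; apply: hx => _.
  by rewrite /h' /= mindicE mem_set ?mulr1.
rewrite ge0_integralTE//; apply: ereal_sup_ubound; exists h' => //= x.
rewrite /h' /= mindicE; have [Nx|Nx] := pselect (N x).
  by rewrite memNset ?mulr0//; apply.
by rewrite mem_set// mulr1 -fg.
Qed.

Lemma L2_sum_off_null (a b : nat -> X -> R) (f : X -> R) (N : set X) :
  measurable N -> mu N = 0 -> (forall j x, ~ N x -> a j x = b j x) ->
  L2_sum mu a f -> L2_sum mu b f.
Proof.
move=> mN N0 ab [Lf h]; split => //.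
suff -> : (fun n => L2dist mu (fun x => (\sum_(j < n) b j x)%R) f) =
          (fun n => L2dist mu (fun x => (\sum_(j < n) a j x)%R) f) by [].
apply/funext => n; rewrite /L2dist unlock; congr (_ `^ _).
apply: (ge0_lower_integral_off_null mN N0) => [x|x|x Nx]; try exact: poweR_ge0.
by congr (`| _%:E | `^ _); congr (_ - _)%R; apply: eq_bigr => j _; rewrite ab.
Qed.

End lower_integral.

(** * Joint measurability of continuous fields on a manifold *)

Section borel_manifold.
Context {R : realType} {n : nat} {M : ptopologicalType}.
Variable g : riemannian_structure R n M.

Lemma open_borel (D : set M) : open D -> measurable (D : set (borel M)).
Proof. by move=> oD; exact: sub_sigma_algebra. Qed.

Lemma open_continuous_borel_measurable (D : set M) (f : M -> R) : open D ->
  (forall m, D m -> {for m, continuous f}) ->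
  measurable_fun (D : set (borel M)) f.
Proof.
move=> oD cf; apply: (measurability _ (RGenOpens.measurableE R)).
move=> _ [_ [a [b ->] <-]]; apply: open_borel; rewrite openE => m [Dm fm].
apply: filterI; first exact: open_nbhs_nbhs.
by apply: (cf m Dm); apply: open_nbhs_nbhs; split => //; exact: interval_open.
Qed.

Lemma smooth_fun_continuous (f : M -> R) : smooth_fun g f -> continuous f.
Proof.
move=> sf m; have [i im] := chart_cover g m.
have [cf _] := sf i [::] (chart i m) (ex_intro2 _ _ m im erefl).
have h : (f \o chart_inv i) \o chart i @ m --> f m.
  have -> : f m = (f \o chart_inv i) (chart i m) by rewrite /= chartK.
  exact: (cvg_comp _ _ (chart_continuous im) cf).
apply: cvg_trans h; apply: near_eq_cvg.
have : nbhs m (chart_dom i) by apply: open_nbhs_nbhs; split => //; exact: chart_dom_open.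
by apply: filterS => y iy; rewrite /= chartK.
Qed.

Lemma grid_round_le (x : R) (N : nat) :
  `|x - (Num.floor (N.+1%:R * x))%:~R / N.+1%:R| <= N.+1%:R^-1.
Proof.
have N0 : 0 < N.+1%:R :> R by rewrite ltr0n.
have /andP[h1 h2] := floor_itv (N.+1%:R * x).
rewrite intrD in h2.
have -> : x - (Num.floor (N.+1%:R * x))%:~R / N.+1%:R =
    (N.+1%:R * x - (Num.floor (N.+1%:R * x))%:~R) / N.+1%:R by field; rewrite lt0r_neq0.
rewrite normrM normfV (gtr0_norm N0) ger0_norm ?subr_ge0// ler_pdivrMr// mulVf ?lt0r_neq0//.
by lra.
Qed.

(** Charts are continuous on open domains, so that each condition on a rounded
coordinate is a Borel condition: it says that the coordinate lies in a
half-open interval of length 1 / (N + 1). *)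
Lemma chart_cell_measurable (i : chart_index g) (N : nat) (z : 'rV[int]_n) :
  measurable ([set m | chart_dom i m /\
    forall k, Num.floor (N.+1%:R * chart i m 0 k) = z 0 k] : set (borel M)).
Proof.
have oD := chart_dom_open i.
have -> : [set m | chart_dom i m /\ forall k, Num.floor (N.+1%:R * chart i m 0 k) = z 0 k] =
  chart_dom i `&` \bigcap_(k in [set: 'I_n]) (chart_dom i `&`
    (fun m => N.+1%:R * chart i m 0 k) @^-1` `[(z 0 k)%:~R, (z 0 k + 1)%:~R[).
  apply/seteqP; split=> m [im /= h]; split=> // k.
    by move=> _; split => //=; rewrite -(h k) in_itv/= floor_itv.
  have [_ /=] := h k I; rewrite in_itv/= => /floor_def; exact.
apply: measurableI; first exact: open_borel.
apply: fin_bigcap_measurable => // k _.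
have mf : measurable_fun (chart_dom i : set (borel M)) (fun m => N.+1%:R * chart i m 0 k).
  apply: open_continuous_borel_measurable => // m im.
  have : chart i y 0 k @[y --> m] --> chart i m 0 k.
    exact: (cvg_comp _ _ (chart_continuous im) (@coord_continuous _ _ _ 0 k _)).
  exact: cvgMl_tmp.
by apply: mf => //; exact: open_borel.
Qed.

Lemma grid_point_cvg (i : chart_index g) m : chart_dom i m ->
  chart_inv i (\row_k ((Num.floor (N.+1%:R * chart i m 0 k))%:~R / N.+1%:R))
    @[N --> \oo] --> m.
Proof.
move=> im; have im' : chart_im i (chart i m) by exists m.
rewrite -[X in _ --> X](chartK im).
pose y N : 'rV[R]_n := \row_k ((Num.floor (N.+1%:R * chart i m 0 k))%:~R / N.+1%:R).
suff h : y N @[N --> \oo] --> chart i m.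
  exact: (cvg_comp _ _ h (chart_inv_continuous im')).
apply/cvg_ballP => e e0.
have [N0 _ HN0] := near_infty_natSinv_lt (PosNum e0).
exists N0 => // N /= N0N; split=> // a k; rewrite ord1 mxE /ball/=.
exact: le_lt_trans (grid_round_le _ _) (HN0 N N0N).
Qed.

Hypothesis M_compact : compact [set: M].

Lemma countable_atlas : exists idx : nat -> chart_index g,
  forall m, exists j, chart_dom (idx j) m.
Proof.
have /choice[i im] := chart_cover g.
move: M_compact; rewrite compact_cover => /(_ M setT (fun m => chart_dom (i m))).
case=> [m _|m _|D _ cov]; [exact: chart_dom_open|by exists m|].
exists (fun j => i (nth point (finmap.enum_fset D) j)) => m.
have [a aD am] := cov m I; exists (index a (finmap.enum_fset D)).
by rewrite nth_index.
Qed.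

(** Rounding in charts makes the identity of M a pointwise limit of Borel maps with
countably many values. This plays the part of a countable dense subset
of a metric space. *)
Lemma measurable_discretization : exists (K : countType)
    (cell : nat -> M -> K) (pt : nat -> K -> M),
  (forall N k, measurable (cell N @^-1` [set k] : set (borel M))) /\
  (forall m, pt N (cell N m) @[N --> \oo] --> m).
Proof.
have [idx cov] := countable_atlas.
have cov' m : exists j, `[< chart_dom (idx j) m >].
  by have [j jm] := cov m; exists j; apply/asboolP.
pose J m := ex_minn (cov' m).
have Jm m : chart_dom (idx (J m)) m by rewrite /J; case: ex_minnP => j /asboolP.
have mJ j : measurable ([set m | J m = j] : set (borel M)).
  (* J picks the first chart around m, which turns the countable atlas into a partition. *)
  have -> : [set m | J m = j] =
    (chart_dom (idx j) `\` \bigcup_(l in `I_j) chart_dom (idx l) : set (borel M)).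
    apply/seteqP; split=> m /=.
      move=> <-; split => // -[l /= lJ lm]; move: lJ.
      rewrite /J; case: ex_minnP => k _ /(_ l) H lk.
      by have := H (asboolT lm); rewrite leqNgt lk.
    move=> [jm Nl]; rewrite /J; case: ex_minnP => k /asboolP km /(_ j (asboolT jm)).
    rewrite leq_eqVlt => /predU1P[//|kj]; exfalso; apply: Nl; by exists k.
  apply: measurableD; first exact: (open_borel (chart_dom_open _)).
  by apply: bigcup_measurable => l _; exact: (open_borel (chart_dom_open _)).
pose z N j m : 'rV[int]_n := \row_k Num.floor (N.+1%:R * chart (idx j) m 0 k).
(* A rounded point may leave the image of its chart, where its inverse is junk; this
   concerns only finitely many N for each m, so the limit is not affected. *)
exists (nat * 'rV[int]_n)%type, (fun N m => (J m, z N (J m) m)),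
  (fun N (k : nat * 'rV[int]_n) => chart_inv (idx k.1) (\row_l ((k.2 0 l)%:~R / N.+1%:R))); split.
- move=> N [j y].
  have -> : (fun m => (J m, z N (J m) m)) @^-1` [set (j, y)] =
    ([set m | J m = j] `&` [set m | chart_dom (idx j) m /\
    forall k, Num.floor (N.+1%:R * chart (idx j) m 0 k) = y 0 k] : set (borel M)).
    apply/seteqP; split=> m /=.
      by move=> [<- <-]; split => //; split => // k; rewrite mxE.
    move=> [<- [_ yz]]; congr pair; apply/rowP => k.
    by rewrite mxE yz.
  by apply: measurableI => //; exact: chart_cell_measurable.
- move=> m; have := grid_point_cvg (Jm m).
  suff -> : (fun N => chart_inv (idx (J m))
      (\row_k ((Num.floor (N.+1%:R * chart (idx (J m)) m 0 k))%:~R / N.+1%:R))) =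
    (fun N => chart_inv (idx (J m)) (\row_l ((z N (J m) m 0 l)%:~R / N.+1%:R))) by [].
  apply/funext => N; congr chart_inv; apply/rowP => k.
  by rewrite !mxE.
Qed.

(** A field with measurable marginals and continuous paths is jointly measurable:
it is the limit of the fields T (pt N (cell N m)) w, which are measurable
because they take the marginal at one fixed point on each cell. *)
Lemma caratheodory_measurable {d : measure_display} {Om : measurableType d}
    (Z : set Om) (T : M -> Om -> R) :
  measurable Z -> (forall m, measurable_fun setT (T m)) ->
  (forall w, ~ Z w -> continuous (T ^~ w)) ->
  measurable_fun setT (fun z : Om * borel M => T z.2 z.1 * \1_(~` Z) z.1).
Proof.
move=> mZ mT cT; have [K [cell [pt [mcell cvg_pt]]]] := measurable_discretization.
pose F k w := T k w * \1_(~` Z) w.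
have mF k : measurable_fun setT (F k).
  by apply: measurable_funM => //; apply: measurable_indic; exact: measurableC.
apply: (@measurable_fun_cvg _ _ _ _
  (fun N (z : Om * borel M) => F (pt N (cell N z.2)) z.1)).
  move=> N _ B mB; rewrite setTI.
  have -> : (fun z : Om * borel M => F (pt N (cell N z.2)) z.1) @^-1` B =
    \bigcup_k ((F (pt N k) @^-1` B) `*` (cell N @^-1` [set k] : set (borel M))).
    apply/seteqP; split=> -[w m] /=; first by move=> Bw; exists (cell N m).
    by move=> [k _ [/= Bw ck]]; rewrite ck.
  apply: countable_bigcupT_measurable => [|k]; first exact: countableP.
  by apply: measurableX => //; rewrite -[X in measurable X]setTI; exact: mF.
move=> [w m] _ /=; rewrite /F; have [Zw|Zw] := pselect (Z w).
  rewrite indicE memNset; last by apply.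
  by under eq_fun do rewrite mulr0; rewrite mulr0; exact: cvg_cst.
apply: cvgMr_tmp; exact: (cvg_comp _ _ (cvg_pt m) (cT w Zw m)).
Qed.

End borel_manifold.

(** * The Cauchy problem for a field with continuous paths *)

Section eigenbasis.
Context {R : realType} {n : nat} {M : ptopologicalType}.
Variable g : riemannian_structure R n M.
Variable mu : {measure set (borel M) -> \bar R}.
Variables (lambda : nat -> R) (phi : nat -> M -> R).
Hypothesis basis : is_eigenbasis g mu lambda phi.

(** The real-valued integral of phi_j^2 is 1, whereas it would be 0 if the
integral were infinite. *)
Lemma eigenfunction_L2 j : L2 mu (phi j).
Proof.
have mphi : measurable_fun setT (phi j : borel M -> R).
  apply: open_continuous_borel_measurable => [|m _]; first exact: openT.
  exact: (smooth_fun_continuous (eigen_smooth basis j)).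
have norm1 := eigen_orthonormal basis j j; rewrite eqxx in norm1.
apply/L2P; split => //; apply/integrableP; split.
  by apply/measurable_EFinP; exact: measurable_funM.
under eq_integral do rewrite gee0_abs ?lee_fin -?expr2 ?sqr_ge0// expr2.
rewrite ltey; apply/eqP => infinite.
by move: norm1; rewrite /L2_inner /Rintegral infinite => /eqP; rewrite eq_sym oner_eq0.
Qed.

Lemma eigenvalue_ge0 j : 0 <= lambda j.
Proof. by rewrite -(eigen_val0 basis); exact: (eigen_val_mono basis). Qed.

End eigenbasis.

Section measurable_version.
Context {R : realType} {n : nat} {M : ptopologicalType}.
Hypothesis M_compact : compact [set: M].
Variable g : riemannian_structure R n M.
Variable mu : {finite_measure set (borel M) -> \bar R}.
Context {d : measure_display} {Om : measurableType d}.
Variables (P : probability Om R) (T : M -> {RV P >-> R}).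
Hypothesis T_cond : field_conditions P mu T.

(** The field itself need not be jointly measurable, as its paths are arbitrary on
a null set; it is replaced there by 0. *)
Lemma measurable_version : exists (X0 : Om * borel M -> R) (Z : set Om),
  [/\ measurable Z, P Z = 0%E, L2 (P \x mu)%E X0 &
      forall w m, ~ Z w -> X0 (w, m) = T m w].
Proof.
have [Z [mZ Z0 contZ]] := field_continuous T_cond.
exists (fun z => T z.2 z.1 * \1_(~` Z) z.1), Z.
have mX : measurable_fun setT (fun z : Om * borel M => T z.2 z.1 * \1_(~` Z) z.1).
  apply: (caratheodory_measurable g M_compact mZ (T := fun m w => T m w)) => [m|w Zw].
    exact: measurable_funP.
  by apply: contrapT => h; apply: Zw; exact: contZ.
split => //; last by move=> w m Zw /=; rewrite indicE mem_set// mulr1.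
apply/L2P; split => //; apply/integrable12ltyP.
  by apply/measurable_EFinP; exact: measurable_funM.
apply: le_lt_trans (field_L2 T_cond).
apply: ge0_le_lower_integral => w; first exact: integral_ge0.
apply: ge0_le_lower_integral => m //=.
by rewrite -expr2 lee_fin ger0_norm ?sqr_ge0// exprMn ler_piMr ?sqr_ge0//.
Qed.

End measurable_version.

Theorem theorem9 (R : realType) (n : nat) (M : ptopologicalType)
    (M_compact : compact [set: M]) (M_connected : connected [set: M])
    (M_hausdorff : hausdorff_space M)
    (g : riemannian_structure R n M)
    (mu : {finite_measure set (borel M) -> \bar R})
    (mu_g : is_riemannian_measure g mu)
    (lambda : nat -> R) (phi : nat -> M -> R)
    (basis : is_eigenbasis g mu lambda phi)
    (nu : {measure set (measurableTypeR R) -> \bar R})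
    (nu_levy : is_levy_measure nu)
    (d : measure_display) (Omega : measurableType d) (P : probability Omega R)
    (T : M -> {RV P >-> R})
    (T_gauss : gaussian_field P T) (T_cond : field_conditions P mu T) :
  let c (j : nat) (w : Omega) : R := L2_inner mu (fun m => T m w) (phi j) in
  let Psi := laplace_exponent nu in
  (exists u, is_solution P mu lambda phi nu T u) /\
  (forall u : R -> Omega * borel M -> R,
     is_solution P mu lambda phi nu T u <->
     (forall t, 0 <= t ->
        L2_sum (P \x mu)%E
          (fun j z => expR (- t * Psi (lambda j)) * phi j z.2 * c j z.1)
          (u t))).
Proof.
move=> c Psi.
have Lphi := eigenfunction_L2 basis; have phi_orthonormal := eigen_orthonormal basis.
have phi_complete := eigen_complete basis; have lambda_ge0 := eigenvalue_ge0 basis.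
have [X0 [Z [mZ Z0 LX0 X0T]]] := measurable_version M_compact g T_cond.
(* The field, its coefficients and their versions agree off this null set. *)
have mZM : measurable (Z `*` [set: borel M]) by exact: measurableX.
have ZM0 : (P \x mu)%E (Z `*` [set: borel M]) = 0%E.
  by rewrite product_measure1E// [X in (X * _)%E]Z0 mul0e.
have TX0 : {ae (P \x mu)%E, forall z, T z.2 z.1 = X0 z}.
  exists (Z `*` [set: borel M]); split => // -[w m] /= Tw; split => //=.
  by apply: contrapT => Zw; apply: Tw; rewrite X0T.
have series_ext u : is_series_solution mu lambda phi nu P X0 u <->
    (forall t, 0 <= t -> L2_sum (P \x mu)%E
      (fun j z => expR (- t * Psi (lambda j)) * phi j z.2 * c j z.1) (u t)).
  have coefE t j z : ~ (Z `*` [set: borel M]) z ->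
      expR (- t * Psi (lambda j)) *
        @tensor _ _ _ Omega (borel M) (section_coef mu X0 (phi j)) (phi j) z =
      expR (- t * Psi (lambda j)) * phi j z.2 * c j z.1.
    case: z => w m /= Zw; rewrite /tensor /= -mulrA; congr (_ * _); rewrite mulrC.
    congr (_ * L2_inner mu _ _); apply/funext => y.
    by rewrite X0T// => Zw'; apply: Zw.
  split=> Su t /Su; apply: L2_sum_off_null mZM ZM0 _ => j z Zz.
    exact: coefE.
  by rewrite -coefE.
have sol_iff u : is_solution P mu lambda phi nu T u <->
    is_series_solution mu lambda phi nu P X0 u.
  split; first exact: solution_is_series_solution.
  exact: series_solution_is_solution.
split; last by move=> u; rewrite sol_iff.
have [u Su] := series_solution_exists Lphi phi_orthonormal phi_complete lambda_ge0 nu LX0.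
by exists u; apply/sol_iff.
Qed.
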